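(* Let $Y_1,\dots,Y_q$ be locally Lipschitz vector fields on $\mathbb{R}^n$, $Y_j=g_j\cdot\nabla$, satisfying condition (H): for every bounded open $\Omega\subset\mathbb{R}^n$ there is $C_\Omega>0$ with $[Y_j,Y_k]_x:=(Y_jg_k(x)-Y_kg_j(x))\cdot\nabla\in P_x^{C_\Omega}$ for a.e. $x\in\Omega$ and all $j,k$. Then for every $x_0\in\mathbb{R}^n$ we have $p_x=p_{x_0}$ for all $x\in\mathcal{O}^{x_0}$.
   Context: $Y_j=\sum_\alpha g_j^\alpha\partial_\alpha$ with $g_j:\mathbb{R}^n\to\mathbb{R}^n$ locally Lipschitz; $Y_jg_k(x):=Dg_k(x)g_j(x)$, defined a.e. by Rademacher. $P_x:=\mathrm{Span}\{Y_1(x),\dots,Y_q(x)\}$, $p_x:=\dim P_x$, $P_x^r:=\{\sum_j c_jY_j(x):|c|\le r\}$. A subunit path is a Lipschitz $\gamma:[0,T]\to\mathbb{R}^n$ with $\dot\gamma=\sum_j u_j(t)Y_j(\gamma)$ a.e., $u$ measurable, $|u(t)|\le1$ a.e. $d(x,y)$ is the infimum of $T\ge0$ such that a subunit path on $[0,T]$ joins $x$ to $y$ ($=\infty$ if none exists), and $\mathcal{O}^{x_0}:=\{y:d(x_0,y)<\infty\}$. *)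

(* Defs.v *)
From Stdlib Require Import Reals.
From mathcomp Require Import ssreflect ssrfun ssrbool eqtype ssrnat seq fintype bigop.
Open Scope R_scope.

Definition vec (n : nat) := 'I_n -> R.

Definition sumR {n : nat} (f : 'I_n -> R) : R := \big[Rplus/R0]_(i < n) f i.
Definition prodR {n : nat} (f : 'I_n -> R) : R := \big[Rmult/R1]_(i < n) f i.

Definition vnorm {n : nat} (v : vec n) : R := sqrt (sumR (fun i => v i * v i)).
Definition vsub {n : nat} (v w : vec n) : vec n := fun i => v i - w i.
Definition vadd {n : nat} (v w : vec n) : vec n := fun i => v i + w i.

Definition lincomb {q n : nat} (c : 'I_q -> R) (w : 'I_q -> vec n) : vec n :=
  fun a => sumR (fun j => c j * w j a).

(* the family Y_1(x),...,Y_q(x), the field Y_j being identified with g_j *)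
Definition Yat {q n : nat} (g : 'I_q -> vec n -> vec n) (x : vec n) : 'I_q -> vec n :=
  fun j => g j x.

Definition inP {q n : nat} (g : 'I_q -> vec n -> vec n) (x : vec n) (v : vec n) : Prop :=
  exists c : 'I_q -> R, forall a, v a = lincomb c (Yat g x) a.

Definition inPr {q n : nat} (g : 'I_q -> vec n -> vec n) (r : R) (x : vec n) (v : vec n) : Prop :=
  exists c : 'I_q -> R, vnorm c <= r /\ forall a, v a = lincomb c (Yat g x) a.

Definition lin_indep {m n : nat} (w : 'I_m -> vec n) : Prop :=
  forall c : 'I_m -> R, (forall a, lincomb c w a = 0) -> forall i, c i = 0.

(* dimP g x m  <->  p_x = dim P_x = m  (dimension = maximal number of
   linearly independent vectors of the subspace P_x) *)
Definition dimP {q n : nat} (g : 'I_q -> vec n -> vec n) (x : vec n) (m : nat) : Prop :=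
  (exists w : 'I_m -> vec n, (forall i, inP g x (w i)) /\ lin_indep w) /\
  ~ (exists w : 'I_(S m) -> vec n, (forall i, inP g x (w i)) /\ lin_indep w).

Definition locally_lipschitz {n : nat} (f : vec n -> vec n) : Prop :=
  forall x : vec n, exists delta, 0 < delta /\ exists L,
    forall y z, vnorm (vsub y x) < delta -> vnorm (vsub z x) < delta ->
      vnorm (vsub (f y) (f z)) <= L * vnorm (vsub y z).

Definition frechet {n : nat} (f : vec n -> vec n) (x : vec n) (A : 'I_n -> 'I_n -> R) : Prop :=
  forall eps, 0 < eps -> exists delta, 0 < delta /\
    forall h : vec n, vnorm h < delta ->
      vnorm (fun i => f (vadd x h) i - f x i - sumR (fun b => A i b * h b)) <= eps * vnorm h.

Definition boxvol {n : nat} (a b : vec n) : R := prodR (fun i => b i - a i).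

Definition nullset {n : nat} (N : vec n -> Prop) : Prop :=
  forall eps, 0 < eps -> exists a b : nat -> vec n,
    (forall m i, a m i <= b m i) /\
    (forall x, N x -> exists m, forall i, a m i <= x i <= b m i) /\
    (forall K, sum_f_R0 (fun m => boxvol (a m) (b m)) K <= eps).

Definition ae_on {n : nat} (Omega : vec n -> Prop) (P : vec n -> Prop) : Prop :=
  nullset (fun x => Omega x /\ ~ P x).

Definition is_open {n : nat} (Omega : vec n -> Prop) : Prop :=
  forall x, Omega x -> exists r, 0 < r /\ forall y, vnorm (vsub y x) < r -> Omega y.

Definition is_bounded {n : nat} (Omega : vec n -> Prop) : Prop :=
  exists M, forall x, Omega x -> vnorm x <= M.

Definition outer_le1 (E : R -> Prop) (s : R) : Prop :=
  forall eps, 0 < eps -> exists a b : nat -> R,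
    (forall m, a m <= b m) /\
    (forall t, E t -> exists m, a m <= t <= b m) /\
    (forall K, sum_f_R0 (fun m => b m - a m) K <= s + eps).

Definition null1 (E : R -> Prop) : Prop := outer_le1 E 0.

Definition open1 (G : R -> Prop) : Prop :=
  forall t, G t -> exists r, 0 < r /\ forall s, Rabs (s - t) < r -> G s.

Definition meas_set1 (E : R -> Prop) : Prop :=
  forall eps, 0 < eps -> exists G, open1 G /\ (forall t, E t -> G t) /\
    outer_le1 (fun t => G t /\ ~ E t) eps.

Definition measurable_on (T : R) (f : R -> R) : Prop :=
  forall a, meas_set1 (fun t => 0 <= t <= T /\ a < f t).

Definition subunit {q n : nat} (g : 'I_q -> vec n -> vec n) (T : R) (gamma : R -> vec n) : Prop :=
  0 <= T /\
  (exists L, forall s t, 0 <= s <= T -> 0 <= t <= T ->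
      vnorm (vsub (gamma s) (gamma t)) <= L * Rabs (s - t)) /\
  exists u : R -> 'I_q -> R,
    (forall j, measurable_on T (fun t => u t j)) /\
    null1 (fun t => 0 <= t <= T /\
      ~ (vnorm (u t) <= 1 /\
         forall i, derivable_pt_lim (fun s => gamma s i) t
                     (lincomb (u t) (Yat g (gamma t)) i))).

(* y \in O^{x0}, i.e. d(x0,y) < infinity *)
Definition orbit {q n : nat} (g : 'I_q -> vec n -> vec n) (x0 y : vec n) : Prop :=
  exists T (gamma : R -> vec n), subunit g T gamma /\
    (forall i, gamma 0 i = x0 i) /\ (forall i, gamma T i = y i).

Definition condH {q n : nat} (g : 'I_q -> vec n -> vec n) : Prop :=
  forall Omega : vec n -> Prop, is_open Omega -> is_bounded Omega ->
    exists C, 0 < C /\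
      ae_on Omega (fun x => forall j k : 'I_q,
        exists Aj Ak, frechet (g j) x Aj /\ frechet (g k) x Ak /\
          inPr g C x (fun i => sumR (fun b => Ak i b * g j x b)
                             - sumR (fun b => Aj i b * g k x b))).

(* Main.v *)
Require Import Defs.
From mathcomp Require Import boolp Rstruct.
From Stdlib Require Import Reals Lra Lia Classical.
From mathcomp Require Import ssreflect ssrfun ssrbool eqtype ssrnat seq fintype finfun bigop.
From mathcomp Require Import ssralg matrix mxalgebra perm.
Import GRing.Theory.
Open Scope R_scope.

(** Let [G(x)] be the matrix whose columns are the fields at [x], and fix [p].  At a point [z] where
    the commutator condition holds, [D_v G = B G + G E] for [v] a combination of the fields with
    coefficients in the unit ball and bounded matrices [B], [E]; hence the [p]-minors of [G]
    satisfy [|D_v F| <= C |F|] at almost every [z].  The curve may lie in the exceptional null set,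
    but the estimate for difference quotients survives at every point: a segment in the
    direction [v] has arbitrarily close parallel translates that meet the exceptional set in
    arbitrarily small length, and the minors are Lipschitz.  Hence the minors obey a Gronwall
    inequality along every subunit curve, in both time directions, so the condition that all
    [p]-minors vanish is constant along the curve, for every [p]. *)

(** * Lipschitz functions on an interval *)

(** The commutator condition acts through the exchange [A_k g_j = A_j g_k + sum_l c_l g_l], with
    [A_j] the derivative of [g_j]. Summed against the coefficients of [v], it turns the derivative
    [A_k v] of column [k] into [B g_k], with [B] independent of [k], plus a combination of columns.
    By multilinearity, [B] replaces a row index of a minor and [E] a column index. A minor is thus
    controlled by the other minors and not by itself alone, so Gronwall is applied to the sum of the
    absolute values of all [p]-minors. The direction is frozen at one point [x], while the estimate
    is used at nearby [z], where [v] is only nearly the same combination of the fields. That error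
    is proportional to the distance and is absorbed by the arbitrary [eta] in the differential
    inequalities. Null sets are given by countable covers by boxes, so integration is replaced by
    counting: averaging over a finite grid of translates treats finitely many boxes, and a cluster
    point of the chosen translates treats all of them. *)

Lemma sum_f_R0_mono (u w : nat -> R) N :
  (forall m, u m <= w m) -> sum_f_R0 u N <= sum_f_R0 w N.
Proof. by move=> H; apply: sum_Rle => m _; apply: H. Qed.

Lemma sum_f_R0_extend (u : nat -> R) N N' :
  (forall m, 0 <= u m) -> (N <= N')%coq_nat -> sum_f_R0 u N <= sum_f_R0 u N'.
Proof.
move=> u0; elim=> [|k _ IH]; first lra.
by rewrite /=; move: (u0 (S k)); lra.
Qed.

Lemma sum_f_R0_incr (u w : nat -> R) h m N :
  (forall k, u k <= w k) -> u m + h <= w m -> (m <= N)%coq_nat ->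
  sum_f_R0 u N + h <= sum_f_R0 w N.
Proof.
move=> uw um; elim: N => [|N IH] mN.
  have mE : m = 0%N by lia.
  by rewrite mE in um; rewrite /=; lra.
have [mE|mN'] : m = S N \/ (m <= N)%coq_nat by lia.
  by subst m; rewrite /=; move: (sum_f_R0_mono u w N uw); lra.
by rewrite /=; move: (IH mN') (uw (S N)); lra.
Qed.

Lemma sum_half_pow N : sum_f_R0 (fun m => (/2) ^ (S m)) N <= 1.
Proof.
suff -> : sum_f_R0 (fun m => (/2) ^ (S m)) N = 1 - (/2) ^ (S N).
  by have := pow_lt (/2) (S N); lra.
elim: N => [|N IH]; first by rewrite /=; lra.
rewrite [LHS]/= -/(sum_f_R0 _ _) IH /=; lra.
Qed.

Lemma lub_approach (E : R -> Prop) s e : is_lub E s -> 0 < e ->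
  exists t, E t /\ s - e < t <= s.
Proof.
move=> [ub least] e0; apply: NNPP => H.
have : s <= s - e; last lra.
apply: least => t Et; apply: Rnot_lt_le => lt; apply: H.
by exists t; split=> //; split=> //; apply: ub.
Qed.

(** The supremum of the points of [[a, b]] that satisfy [P] satisfies it by the limit hypothesis,
    and a step from there would exceed the supremum unless it is [b]. The points with [P] need not
    form an interval. *)
Lemma real_induction (a b : R) (P : R -> Prop) :
  a <= b -> P a ->
  (forall t, a <= t < b -> P t -> exists h, 0 < h /\ t + h <= b /\ P (t + h)) ->
  (forall t, a < t <= b -> (forall e, 0 < e -> exists s, t - e < s <= t /\ a <= s /\ P s) -> P t) ->
  P b.
Proof.
move=> ab Pa step lim.
pose E t := a <= t <= b /\ P t.
have [||s sE] := completeness E.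
- by exists b => t [] [].
- by exists a; split=> //; lra.
have as_ : a <= s by apply: (proj1 sE); split=> //; lra.
have sb : s <= b by apply: (proj2 sE) => t [] [].
have Ps : P s.
  have [sa|sa] := Req_dec s a; first by rewrite sa.
  apply: lim; first lra.
  move=> e e0; have [t [[tb Pt] ts]] := lub_approach E s e sE e0.
  by exists t; split=> //; split=> //; lra.
have [<- //|sb'] := Req_dec s b.
have [h [h0 [shb Psh]]] := step s ltac:(lra) Ps.
suff : s + h <= s by lra.
by apply: (proj1 sE); split=> //; lra.
Qed.

Definition right_dini_nonpos (f : R -> R) (b t : R) : Prop :=
  forall eta, 0 < eta -> exists delta, 0 < delta /\
    forall h, 0 < h < delta -> t + h <= b -> f (t + h) - f t <= eta * h.

Definition lipschitz_between (f : R -> R) (a b K : R) : Prop :=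
  forall s t, a <= s <= b -> a <= t <= b -> Rabs (f s - f t) <= K * Rabs (s - t).

Section Dini.
Variables (f : R -> R) (a b K eps : R) (l r : nat -> R).
Hypotheses (ab : a <= b) (K0 : 0 <= K) (e0 : 0 < eps)
  (f_lip : lipschitz_between f a b K)
  (sum_lr : forall N, sum_f_R0 (fun m => r m - l m) N <= eps)
  (lr : forall m, l m <= r m)
  (f_dini : forall t, a <= t < b -> (forall m, ~ (l m <= t <= r m)) -> right_dini_nonpos f b t).

(** The right ends are pushed outwards so that from every point of a bad interval, its right end
    included, one can advance by a positive amount; this adds at most [eps] to the total length.
    [len t m] measures the part of the enlarged interval that lies before [t]. *)
Let r' m := r m + eps * (/2) ^ (S m).
Let len t m := Rmax 0 (Rmin t (r' m) - l m).

Let r'_gt m : r m < r' m.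
Proof. by rewrite /r'; have : 0 < eps * (/2) ^ (S m); [apply: Rmult_lt_0_compat => //; apply: pow_lt; lra | lra]. Qed.

Let len_mono s t m : s <= t -> len s m <= len t m.
Proof.
move=> st; apply: Rle_max_compat_l.
by have := Rle_min_compat_r _ _ (r' m) st; lra.
Qed.

Let len_ge0 t m : 0 <= len t m.
Proof. exact: Rmax_l. Qed.

Let sum_len_le t N : sum_f_R0 (len t) N <= 2 * eps.
Proof.
apply: (Rle_trans _ (sum_f_R0 (fun m => (r m - l m) + (/2) ^ (S m) * eps) N)).
  apply: sum_f_R0_mono => m; have := r'_gt m; have := lr m; rewrite /len /r'.
  by have := Rmin_r t (r' m); rewrite /r' => *; apply: Rmax_lub; lra.
rewrite sum_plus -scal_sum; have := sum_half_pow N; have := sum_lr N.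
by move=> ??; have : eps * sum_f_R0 (fun m => (/2) ^ (S m)) N <= eps * 1; [apply: Rmult_le_compat_l; lra | lra].
Qed.

(** Inside the bad intervals [f] grows at most at its Lipschitz rate, which is charged to their
    length; elsewhere the Dini condition allows only an arbitrarily small slope. *)
Lemma dini_le : f b - f a <= K * (2 * eps).
Proof.
suff H eta : 0 < eta -> f b - f a <= K * (2 * eps) + eta.
  by apply: Rnot_lt_le => lt; have := H ((f b - f a - K * (2 * eps)) / 2) ltac:(lra); lra.
move=> eta0; pose et := eta / (2 * (b - a + 1)).
have et0 : 0 < et by apply: Rdiv_lt_0_compat; lra.
have etE : et * (b - a) <= eta / 2.
  have -> : eta / 2 = et * (b - a + 1) by rewrite /et; field; lra.
  by apply: Rmult_le_compat_l; lra.
(* Partial sums with a slack [z] stand for the full series of lengths. The slack also pays for the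
   limit step, where [f] is compared with a slightly earlier point. *)
pose P t := forall z, 0 < z -> exists N,
  f t - f a <= et * (t - a) + K * sum_f_R0 (len t) N + z.
have : P b.
  apply: (real_induction a b P) => //.
  - move=> z z0; exists 0%N; rewrite /=; have := Rmult_le_pos _ _ K0 (len_ge0 a 0); lra.
  - move=> t tab Pt.
    have [[m tm]|nm] := classic (exists m, l m <= t <= r m).
      (* Jump to the end of the enlarged interval: [len] of index [m] grows by exactly the step,
         which covers the Lipschitz growth of [f]. *)
      exists (Rmin (b - t) (r' m - t)); have rm := r'_gt m.
      have h0 : 0 < Rmin (b - t) (r' m - t) by apply: Rmin_glb_lt; lra.
      have hb := Rmin_l (b - t) (r' m - t); have hr := Rmin_r (b - t) (r' m - t).
      move: (Rmin _ _) h0 hb hr => h h0 hb hr; split=> //; split; first lra.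
      move=> z z0; have [N HN] := Pt z z0; exists (Nat.max N m).
      have := f_lip (t + h) t ltac:(lra) ltac:(lra).
      rewrite (_ : t + h - t = h); last ring.
      rewrite (Rabs_pos_eq h); last lra.
      move=> /(Rle_trans _ _ _ (Rle_abs _)) fh.
      have S1 := sum_f_R0_extend (len t) N (Nat.max N m) (len_ge0 t) ltac:(lia).
      have S2 : sum_f_R0 (len t) (Nat.max N m) + h <= sum_f_R0 (len (t + h)) (Nat.max N m).
        apply: (sum_f_R0_incr _ _ _ m); last lia.
          by move=> k; apply: len_mono; lra.
        by rewrite /len !Rmin_left ?Rmax_right; lra.
      have := Rmult_le_compat_l K _ _ K0 (Rle_trans _ _ _ (Rplus_le_compat_r h _ _ S1) S2).
      have : 0 <= et * h by apply: Rmult_le_pos; lra.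
      lra.
    have [|d [d0 Hd]] := f_dini t tab _ et et0.
      by move=> m tm; apply: nm; exists m.
    exists (Rmin (b - t) (d / 2)).
    have h0 : 0 < Rmin (b - t) (d / 2) by apply: Rmin_glb_lt; lra.
    have hb := Rmin_l (b - t) (d / 2); have hr := Rmin_r (b - t) (d / 2).
    move: (Rmin _ _) h0 hb hr => h h0 hb hr; split=> //; split; first lra.
    move=> z z0; have [N HN] := Pt z z0; exists N.
    have := Hd h ltac:(lra) ltac:(lra).
    have S2 : sum_f_R0 (len t) N <= sum_f_R0 (len (t + h)) N.
      by apply: sum_f_R0_mono => k; apply: len_mono; lra.
    have := Rmult_le_compat_l K _ _ K0 S2; lra.
  - move=> t tab Hs z z0.
    have ez0 : 0 < z / (2 * (K + 1)) by apply: Rdiv_lt_0_compat; lra.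
    have [s [st [as_ Ps]]] := Hs _ ez0.
    have [N HN] := Ps (z / 2) ltac:(lra); exists N.
    have := f_lip t s ltac:(lra) ltac:(lra).
    rewrite (Rabs_pos_eq (t - s)); last lra.
    move=> /(Rle_trans _ _ _ (Rle_abs _)) fh.
    have S2 : sum_f_R0 (len s) N <= sum_f_R0 (len t) N.
      by apply: sum_f_R0_mono => k; apply: len_mono; lra.
    have := Rmult_le_compat_l K _ _ K0 S2.
    have : K * (t - s) <= z / 2.
      have -> : z / 2 = (K + 1) * (z / (2 * (K + 1))) by field; lra.
      by apply: Rmult_le_compat; lra.
    have : et * (s - a) <= et * (t - a) by apply: Rmult_le_compat_l; lra.
    lra.
move=> /(_ (eta / 2) ltac:(lra)) [N HN].
have := Rmult_le_compat_l K _ _ K0 (sum_len_le b N); lra.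
Qed.

End Dini.

Lemma dini_null_le f a b K (E : R -> Prop) :
  a <= b -> 0 <= K -> lipschitz_between f a b K -> null1 E ->
  (forall t, a <= t < b -> ~ E t -> right_dini_nonpos f b t) ->
  f b <= f a.
Proof.
move=> ab K0 fl nE fd; apply: Rnot_lt_le => lt.
(* With this [e] the bound [K * (2 * e)] falls strictly below [f b - f a]. *)
pose e := (f b - f a) / (4 * (K + 1)).
have e0 : 0 < e by apply: Rdiv_lt_0_compat; lra.
have [l [r [lr [cov sm]]]] := nE e e0.
have := dini_le f a b K e l r ab K0 e0 fl (fun N => ltac:(have := sm N; lra)) lr.
have -> : f b - f a = 4 * (K + 1) * e by rewrite /e; field; lra.
have H : K * e < (K + 1) * e by apply: Rmult_lt_compat_r; lra.
have H' : 0 <= K * e by apply: Rmult_le_pos; lra.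
suff H2 : forall t, a <= t < b -> (forall m, ~ (l m <= t <= r m)) -> right_dini_nonpos f b t.
  by move=> /(_ H2); lra.
move=> t tab nt; apply: fd => // Et.
by have [m tm] := cov t Et; apply: (nt m).
Qed.

(** Difference-quotient form of [|f'| <= C f] at [t]. It is two-sided in [h], so that it survives
    time reversal. *)
Definition log_dini_le (C : R) (f : R -> R) (a b t : R) : Prop :=
  forall eta, 0 < eta -> exists delta, 0 < delta /\
    forall h, Rabs h < delta -> a <= t + h <= b ->
      Rabs (f (t + h) - f t) <= Rabs h * (C * f t + eta).

Lemma exp_opp_lipschitz C s t : 0 <= C -> 0 <= s -> 0 <= t ->
  Rabs (exp (- C * s) - exp (- C * t)) <= C * Rabs (s - t).
Proof.
have main x y : 0 <= C -> 0 <= x -> x <= y ->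
    Rabs (exp (- C * x) - exp (- C * y)) <= C * Rabs (x - y).
  move=> C0 x0 xy; have Cxy : 0 <= C * (y - x) by apply: Rmult_le_pos; lra.
  have -> : exp (- C * y) = exp (- C * x) * exp (- (C * (y - x))).
    by rewrite -exp_plus; congr exp; ring.
  have ex1 : exp (- C * x) <= 1.
    rewrite -exp_0; case: (Req_dec (C * x) 0) => h; first by right; congr exp; lra.
    by left; apply: exp_increasing; have := Rmult_le_pos _ _ C0 x0; lra.
  have e0 := exp_pos (- C * x).
  have em1 : exp (- (C * (y - x))) <= 1.
    case: (Req_dec (C * (y - x)) 0) => [->|h]; first by rewrite Ropp_0 exp_0; lra.
    by rewrite -exp_0; left; apply: exp_increasing; lra.
  have e1 := exp_ineq1_le (- (C * (y - x))).
  rewrite Rabs_pos_eq; last by nra.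
  by rewrite (Rabs_left1 (x - y)); nra.
move=> C0 s0 t0; case: (Rle_dec s t) => st; first exact: main.
by rewrite Rabs_minus_sym (Rabs_minus_sym s); apply: main => //; lra.
Qed.

(** The product of [f] with the integrating factor [exp (- C * (t - a))] is Lipschitz with
    nonpositive right Dini derivative off [E], hence at [b] it is at most its value [0] at [a]. *)
Lemma gronwall_zero_fwd f a b K C (E : R -> Prop) :
  a <= b -> 0 <= K -> 0 <= C -> lipschitz_between f a b K -> null1 E ->
  (forall t, a <= t <= b -> 0 <= f t) ->
  (forall t, a <= t <= b -> ~ E t -> log_dini_le C f a b t) ->
  f a = 0 -> f b = 0.
Proof.
move=> ab K0 C0 fl nE f0 fd fa.
pose N t := exp (- C * (t - a)) * f t.
have f_le t : a <= t <= b -> f t <= K * (b - a).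
  move=> tab; have := fl t a tab ltac:(lra).
  rewrite fa (Rabs_pos_eq (t - a)); last lra.
  move=> /(Rle_trans _ _ _ (Rle_abs _)) H.
  have : K * (t - a) <= K * (b - a) by apply: Rmult_le_compat_l; lra.
  lra.
have e1 t : a <= t -> exp (- C * (t - a)) <= 1.
  move=> at_; have Ct : 0 <= C * (t - a) by apply: Rmult_le_pos; lra.
  case: (Req_dec (C * (t - a)) 0) => h.
    by rewrite (_ : - C * (t - a) = 0) ?exp_0; lra.
  by rewrite -exp_0; left; apply: exp_increasing; lra.
have : N b <= N a.
  (* Lipschitz constant of a product: the exponential is at most [1] and [C]-Lipschitz, while [f] is
     [K]-Lipschitz and, since [f a = 0], at most [K * (b - a)]. *)
  apply: (dini_null_le N a b (K + C * (K * (b - a))) E) => //.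
  - have : 0 <= C * (K * (b - a)) by apply: Rmult_le_pos => //; apply: Rmult_le_pos; lra.
    lra.
  - move=> s t sab tab.
    have -> : N s - N t = exp (- C * (s - a)) * (f s - f t)
        + (exp (- C * (s - a)) - exp (- C * (t - a))) * f t by rewrite /N; ring.
    apply: Rle_trans (Rabs_triang _ _) _; rewrite !Rabs_mult.
    have fst := fl s t sab tab.
    have ex := exp_opp_lipschitz C (s - a) (t - a) C0 ltac:(lra) ltac:(lra).
    rewrite (_ : s - a - (t - a) = s - t) in ex; last ring.
    rewrite (Rabs_pos_eq (exp _)); last by left; apply: exp_pos.
    rewrite (Rabs_pos_eq (f t)); last exact: f0.
    have H1 : exp (- C * (s - a)) * Rabs (f s - f t) <= 1 * (K * Rabs (s - t)).
      apply: Rmult_le_compat => //; [by left; apply: exp_pos | exact: Rabs_pos | by apply: e1; lra].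
    have H2 : Rabs (exp (- C * (s - a)) - exp (- C * (t - a))) * f t
        <= (C * Rabs (s - t)) * (K * (b - a)).
      by apply: Rmult_le_compat => //; [exact: Rabs_pos | exact: f0 | exact: f_le].
    lra.
  - move=> t tab nEt eta eta0.
    have [d [d0 Hd]] := fd t ltac:(lra) nEt eta eta0.
    exists d; split=> // h h0 thb.
    have := Hd h ltac:(rewrite Rabs_pos_eq; lra) ltac:(lra).
    rewrite (Rabs_pos_eq h); last lra.
    move=> /(Rle_trans _ _ _ (Rle_abs _)) fh.
    have -> : N t = exp (- C * (t + h - a)) * (exp (C * h) * f t).
      by rewrite /N -Rmult_assoc -exp_plus; congr (exp _ * _); ring.
    rewrite /N -Rmult_minus_distr_l.
    have ft := f0 t ltac:(lra).
    have ech := exp_ineq1_le (C * h).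
    (* Uses [1 + C * h <= exp (C * h)]. *)
    have H : f (t + h) - exp (C * h) * f t <= eta * h by nra.
    have H1 := e1 (t + h) ltac:(lra); have H2 := exp_pos (- C * (t + h - a)).
    have : 0 <= eta * h by nra.
    nra.
rewrite /N fa Rmult_0_r => H.
have := f0 b ltac:(lra); have := exp_pos (- C * (b - a)); nra.
Qed.

Lemma null1_reflect (E : R -> Prop) c : null1 E -> null1 (fun t => E (c - t)).
Proof.
move=> nE e e0; have [l [r [lr [cov sm]]]] := nE e e0.
exists (fun m => c - r m), (fun m => c - l m); split; first by move=> m; have := lr m; lra.
split; first by move=> t /cov [m ?]; exists m; lra.
move=> N; rewrite (PartSum.sum_eq _ (fun m => r m - l m)); first exact: sm.
by move=> i _; ring.
Qed.

Lemma gronwall_zero f a b K C (E : R -> Prop) :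
  a <= b -> 0 <= K -> 0 <= C -> lipschitz_between f a b K -> null1 E ->
  (forall t, a <= t <= b -> 0 <= f t) ->
  (forall t, a <= t <= b -> ~ E t -> log_dini_le C f a b t) ->
  f a = 0 <-> f b = 0.
Proof.
move=> ab K0 C0 fl nE f0 fd; split; first exact: (gronwall_zero_fwd f a b K C E).
(* The converse is the forward statement for the curve reflected by [t -> a + b - t]. *)
move=> fb; have -> : a = a + b - b by ring.
apply: (gronwall_zero_fwd (fun t => f (a + b - t)) a b K C (fun t => E (a + b - t))) => //.
- move=> s t sab tab; rewrite (Rabs_minus_sym s).
  rewrite (_ : t - s = (a + b - s) - (a + b - t)); last ring.
  by apply: fl; lra.
- exact: null1_reflect.
- by move=> t tab; apply: f0; lra.
- move=> t tab nEt eta eta0.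
  have [d [d0 Hd]] := fd (a + b - t) ltac:(lra) nEt eta eta0.
  exists d; split=> // h hd thb; rewrite -(Rabs_Ropp h).
  rewrite (_ : a + b - (t + h) = a + b - t + - h); last ring.
  by apply: Hd; [rewrite Rabs_Ropp | lra].
- by rewrite (_ : a + b - a = b) //; ring.
Qed.

(** * Null sets and parallel segments *)

Lemma bigR_le (I : Type) (s : seq I) (P : pred I) (f g : I -> R) :
  (forall i, P i -> f i <= g i) ->
  \big[Rplus/R0]_(i <- s | P i) f i <= \big[Rplus/R0]_(i <- s | P i) g i.
Proof. by move=> H; apply: (big_ind2 Rle) => //; [lra | move=> *; lra]. Qed.

Lemma bigR_ge0 (I : Type) (s : seq I) (P : pred I) (f : I -> R) :
  (forall i, P i -> 0 <= f i) -> 0 <= \big[Rplus/R0]_(i <- s | P i) f i.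
Proof. by move=> H; apply: (big_ind (Rle 0)) => //; [lra | move=> *; lra]. Qed.

Lemma bigR_const (I : finType) (c : R) : \big[Rplus/R0]_(i : I) c = INR #|I| * c.
Proof.
rewrite big_const; elim: #|_| => [|k IH] /=; first by lra.
by rewrite IH -/(INR (S k)) S_INR; lra.
Qed.

Lemma bigR_abs (I : Type) (s : seq I) (f : I -> R) :
  Rabs (\big[Rplus/R0]_(i <- s) f i) <= \big[Rplus/R0]_(i <- s) Rabs (f i).
Proof.
apply: (big_ind2 (fun x y => Rabs x <= y)); first by rewrite Rabs_R0; lra.
  by move=> x1 x2 y1 y2 *; have := Rabs_triang x1 y1; lra.
by move=> *; lra.
Qed.

Lemma bigR_term_le (I : finType) (f : I -> R) (i : I) :
  (forall j, 0 <= f j) -> f i <= \big[Rplus/R0]_(j : I) f j.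
Proof.
move=> f0; rewrite (bigD1 i) //=.
have := bigR_ge0 _ (index_enum I) (fun j => j != i) f (fun j _ => f0 j); lra.
Qed.

Lemma sum_f_R0_big (f : nat -> R) K : sum_f_R0 f K = \big[Rplus/R0]_(m < K.+1) f m.
Proof.
elim: K => [|K IH]; first by rewrite big_ord1.
by rewrite big_ord_recr /= -IH.
Qed.

Lemma bigprodR_le (I : Type) (s : seq I) (f g : I -> R) :
  (forall i, 0 <= f i <= g i) ->
  \big[Rmult/R1]_(i <- s) f i <= \big[Rmult/R1]_(i <- s) g i.
Proof.
move=> H; have : 0 <= \big[Rmult/R1]_(i <- s) f i <= \big[Rmult/R1]_(i <- s) g i; last by case.
apply: (big_ind2 (fun x y => 0 <= x <= y)) => //; first lra.
by move=> x1 x2 y1 y2 [? ?] [? ?]; split; [apply: Rmult_le_pos | apply: Rmult_le_compat].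
Qed.

Definition indic (P : Prop) : R := if pselect P is left _ then 1 else 0.

Lemma indic_ge0 P : 0 <= indic P.
Proof. by rewrite /indic; case: pselect => ?; lra. Qed.

Lemma indic_le (P Q : Prop) : (P -> Q) -> indic P <= indic Q.
Proof. by rewrite /indic => H; do 2!case: pselect => ?; try lra; tauto. Qed.

Lemma indic_true (P : Prop) : P -> indic P = 1.
Proof. by rewrite /indic; case: pselect. Qed.

Lemma indic_false (P : Prop) : ~ P -> indic P = 0.
Proof. by rewrite /indic; case: pselect. Qed.

Lemma indic_forall (n : nat) (Q : 'I_n -> Prop) :
  indic (forall i, Q i) = \big[Rmult/R1]_(i < n) indic (Q i).
Proof.
have [H|H] := classic (forall i, Q i).
  by rewrite indic_true // big1 // => i _; rewrite indic_true.
rewrite indic_false //; have [i Hi] := not_all_ex_not _ _ H.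
by rewrite (bigD1 i) //= (indic_false (Q i)) // Rmult_0_l.
Qed.

Lemma grid_count_le (a b p c : R) M : a <= b -> 0 < c ->
  (\big[Rplus/R0]_(k < M) indic (a <= p + c * INR k <= b)) * c <= b - a + c.
Proof.
move=> ab c0; pose N M := \big[Rplus/R0]_(k < M) indic (a <= p + c * INR k <= b).
have NS k : N (S k) = N k + indic (a <= p + c * INR k <= b) by rewrite /N big_ord_recr.
(* Strengthened for induction: only the part of [[a, b]] up to the last grid point counts. The extra
   [c] is the difference between the number of points and the number of gaps. *)
suff H : N M * c <= Rmax 0 (Rmin b (p + c * (INR M - 1)) - a + c).
  apply: Rle_trans H _; apply: Rmax_lub; first lra.
  by have := Rmin_l b (p + c * (INR M - 1)); lra.
elim: M => [|M IH]; first by rewrite /N big_ord0 Rmult_0_l; apply: Rmax_l.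
rewrite NS Rmult_plus_distr_r S_INR.
rewrite (_ : INR M + 1 - 1 = INR M); last ring.
have [inab|nin] := classic (a <= p + c * INR M <= b).
  rewrite (indic_true (_ /\ _)) //.
  rewrite Rmin_right in IH; last lra.
  rewrite Rmin_right; last lra.
  have : Rmax 0 (p + c * (INR M - 1) - a + c) <= p + c * INR M - a by apply: Rmax_lub; lra.
  by rewrite (Rmax_right 0 (p + c * INR M - a + c)); lra.
rewrite (indic_false (_ /\ _)) // Rmult_0_l Rplus_0_r; apply: Rle_trans IH _.
apply: Rle_max_compat_l; have := Rle_min_compat_l (p + c * (INR M - 1)) (p + c * INR M) b ltac:(lra).
lra.
Qed.

Lemma grid_count_ge (al be c : R) M : 0 <= al -> 0 < c -> be <= c * INR M ->
  be - al - c <= (\big[Rplus/R0]_(k < M) indic (al <= c * INR k <= be)) * c.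
Proof.
move=> al0 c0 bM; pose N M := \big[Rplus/R0]_(k < M) indic (al <= c * INR k <= be).
have NS k : N (S k) = N k + indic (al <= c * INR k <= be) by rewrite /N big_ord_recr.
suff H : Rmin be (c * INR M) - al - c <= N M * c by rewrite Rmin_left in H.
elim: M {bM} => [|M IH].
  by rewrite /N big_ord0 Rmult_0_l Rmult_0_r; have := Rmin_r be 0; lra.
rewrite NS Rmult_plus_distr_r S_INR.
have ge0 : 0 <= N M * c.
  by apply: Rmult_le_pos; [apply: bigR_ge0 => k _; apply: indic_ge0 | lra].
have [lt|ge] := Rlt_le_dec (c * INR M) al.
  rewrite indic_false; last lra.
  have := Rmin_r be (c * (INR M + 1)); lra.
have [lt|ge'] := Rlt_le_dec be (c * INR M).
  rewrite indic_false; last lra.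
  rewrite Rmin_left in IH; last lra.
  by rewrite Rmin_left; lra.
rewrite indic_true; last lra.
rewrite Rmin_right in IH; last lra.
have := Rmin_r be (c * (INR M + 1)); lra.
Qed.

Definition in_box {n} (a b z : vec n) : Prop := forall i, a i <= z i <= b i.

(* Averaging the left-hand side over the grid points [y = delta k / M], with integer coordinates [0 <= k_i < M]. *)
Lemma grid_translate (n M P K : nat) (pt : 'I_P -> vec n) (a b : nat -> vec n) (delta : R) :
  0 < delta -> (0 < M)%N -> (forall m i, a m i <= b m i) ->
  exists y : vec n, (forall i, 0 <= y i <= delta) /\
    delta ^ n * \big[Rplus/R0]_(m < K) \big[Rplus/R0]_(j < P) indic (in_box (a m) (b m) (vadd (pt j) y))
      <= INR P * \big[Rplus/R0]_(m < K) prodR (fun i => b m i - a m i + delta / INR M).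
Proof.
move=> d0 M0 ab.
have M1 : 0 < INR M by apply: lt_0_INR; apply/ltP.
pose c := delta / INR M.
have c0 : 0 < c by apply: Rdiv_lt_0_compat.
pose y (f : {ffun 'I_n -> 'I_M}) : vec n := fun i => c * INR (f i).
pose S z := \big[Rplus/R0]_(m < K) \big[Rplus/R0]_(j < P) indic (in_box (a m) (b m) (vadd (pt j) z)).
pose A := INR P * \big[Rplus/R0]_(m < K) prodR (fun i => b m i - a m i + c).
have S_avg : c ^ n * \big[Rplus/R0]_(f : {ffun 'I_n -> 'I_M}) S (y f) <= A.
  rewrite /S exchange_big /= /A !big_distrr /=; apply: bigR_le => m _.
  rewrite exchange_big /= big_distrr /=.
  have -> : INR P * prodR (fun i => b m i - a m i + c)
      = \big[Rplus/R0]_(j < P) prodR (fun i => b m i - a m i + c).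
    by rewrite bigR_const card_ord.
  apply: bigR_le => j _.
  under eq_bigr do rewrite /in_box indic_forall.
  (* The indicator of a box is a product over the coordinates, so its sum over the whole grid is a
     product of one-dimensional counts, each bounded by [grid_count_le]. *)
  rewrite -(bigA_distr_bigA (fun i (k : 'I_M) => indic (a m i <= pt j i + c * INR k <= b m i))).
  have -> : c ^ n = \big[Rmult/R1]_(i < n) c.
    by rewrite big_const card_ord; elim: (n) => //= k ->.
  rewrite -big_split /=; apply: bigprodR_le => i; split.
    by apply: Rmult_le_pos; [lra | apply: bigR_ge0 => k _; apply: indic_ge0].
  by rewrite Rmult_comm; apply: grid_count_le.
apply: NNPP => no.
have lt f : A < delta ^ n * S (y f).
  apply: Rnot_le_lt => le; apply: no; exists (y f); split=> // i.
  have lt := ltn_ord (f i); have Ni := pos_INR (f i).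
  have fM : INR (f i) <= INR M by apply: le_INR; apply/leP; apply: ltnW.
  rewrite /y; split; first by apply: Rmult_le_pos; lra.
  have -> : delta = c * INR M by rewrite /c; field; lra.
  by apply: Rmult_le_compat_l; lra.
have cn : 0 < c ^ n by apply: pow_lt.
have dE : delta ^ n = c ^ n * INR (M ^ n).
  have -> : delta = c * INR M by rewrite /c; field; lra.
  rewrite Rpow_mult_distr; congr (_ * _); elim: (n) => [|k IH] //=.
  by rewrite expnS mult_INR IH.
pose f0 : {ffun 'I_n -> 'I_M} := [ffun=> Ordinal M0].
have sum_lt : INR (M ^ n) * A < \big[Rplus/R0]_(f : {ffun 'I_n -> 'I_M}) (delta ^ n * S (y f)).
  rewrite -[X in INR (X ^ n)]card_ord -[X in INR (_ ^ X)]card_ord -card_ffun -bigR_const.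
  rewrite (bigD1 f0) //= [X in _ < X](bigD1 f0) //=.
  apply: Rplus_lt_le_compat; first exact: lt.
  by apply: bigR_le => f _; left.
rewrite -big_distrr /= dE (Rmult_comm (c ^ n)) Rmult_assoc in sum_lt.
have MN : 0 < INR (M ^ n) by apply: lt_0_INR; apply/ltP; rewrite expn_gt0 M0.
by have := Rlt_le_trans _ _ _ sum_lt (Rmult_le_compat_l _ _ _ (Rlt_le _ _ MN) S_avg); lra.
Qed.

(** Continuity at [0] of a polynomial in [th]. The factor [3] leaves room, in [nullset_line_select],
    for widening a box by [th] at both ends and for a grid spacing of at most [th]. *)
Lemma prodR_perturb (n : nat) (d : vec n) (eta : R) : 0 < eta ->
  exists th, 0 < th /\ prodR (fun i => d i + 3 * th) <= prodR d + eta.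
Proof.
move=> eta0.
have cont : continuity_pt (fun th => prodR (fun i => d i + 3 * th)) 0.
  rewrite /prodR; elim: (index_enum _) => [|i s IH].
    have -> : (fun th => \big[Rmult/R1]_(i <- [::]) (d i + 3 * th)) = (fun _ => R1).
      by apply: funext => th; rewrite big_nil.
    exact: continuity_pt_const.
  have -> : (fun th => \big[Rmult/R1]_(j <- i :: s) (d j + 3 * th))
      = (mult_fct (fun th => d i + 3 * th) (fun th => \big[Rmult/R1]_(j <- s) (d j + 3 * th))).
    by apply: funext => th; rewrite big_cons.
  apply: continuity_pt_mult IH; reg.
have [al [al0 Hal]] := cont eta eta0.
exists (al / 2); split; first lra.
have := Hal (al / 2); rewrite /D_x /no_cond /dist /= /Rdist.
have -> : (fun i => d i + 3 * 0) = d by apply: funext => i; lra.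
rewrite Rminus_0_r (Rabs_pos_eq (al / 2)); last lra.
move=> H; have {H} : Rabs (prodR (fun i => d i + 3 * (al / 2)) - prodR d) < eta.
  by apply: H; split; [split=> //; lra | lra].
by move=> /Rabs_def2; lra.
Qed.

(** Bolzano-Weierstrass one coordinate at a time, by induction on a list of coordinates that already
    converge along [sg]. Instead of strictly increasing extractions it is enough to have
    [k <= sg k]. *)
Lemma cluster_point (n : nat) (u : nat -> vec n) (delta : R) :
  (forall k i, 0 <= u k i <= delta) ->
  exists y : vec n, forall e N, 0 < e -> exists k, (N <= k)%coq_nat /\ forall i, Rabs (u k i - y i) < e.
Proof.
move=> ub.
suff [sg [y [sg_ge Hy]]] : exists (sg : nat -> nat) (y : vec n),
    (forall k, (k <= sg k)%coq_nat) /\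
    forall e, 0 < e -> exists N, forall k, (N <= k)%coq_nat -> forall i, i \in enum 'I_n -> Rabs (u (sg k) i - y i) < e.
  exists y => e N e0; have [N' HN'] := Hy e e0.
  exists (sg (Nat.max N N')); split; first by have := sg_ge (Nat.max N N'); lia.
  by move=> i; apply: HN'; [lia | rewrite mem_enum].
elim: (enum _) => [|i s [sg [y [sg_ge Hy]]]].
  exists id, (fun _ => 0); split; first by move=> k; lia.
  by move=> e _; exists 0%N.
have [l Hl] := Bolzano_Weierstrass (fun k => u (sg k) i) (fun c => 0 <= c <= delta)
  (compact_P3 0 delta) (fun k => ub (sg k) i).
have /choice [tau Htau] : forall k, exists p, (k <= p)%coq_nat /\ Rabs (u (sg p) i - l) < / INR (S k).
  move=> k.
  have k0 : 0 < / INR (S k) by apply: Rinv_0_lt_compat; apply: lt_0_INR; lia.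
  have [|p [kp Hp]] := Hl (disc l (mkposreal _ k0)) k; first by exists (mkposreal _ k0).
  by exists p; split.
exists (sg \o tau), (fun j => if j == i then l else y j); split.
  by move=> k /=; have := proj1 (Htau k); have := sg_ge (tau k); lia.
move=> e e0; have [N HN] := Hy e e0.
have [N' [HN' N'0]] := archimed_cor1 e e0.
exists (Nat.max N N') => k kN j /=; rewrite inE.
have [->|ji] /= := eqVneq j i.
  move=> _; apply: Rlt_trans (proj2 (Htau k)) _; apply: Rle_lt_trans HN'.
  apply: Rinv_le_contravar; first exact: lt_0_INR.
  by apply: le_INR; lia.
by move=> js; apply: HN => //; have := proj1 (Htau k); lia.
Qed.

(** [E] is closed and bounded, so it contains its infimum and supremum when it is nonempty. The
    alternative [al = be] serves the empty case, where there are no end points in the box. *)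
Lemma segment_box (n : nat) (p v a b : vec n) (h : R) : 0 < h ->
  let E s := 0 <= s <= h /\ in_box a b (fun i => p i + s * v i) in
  exists al be, 0 <= al <= be /\ be <= h /\ (forall s, E s -> al <= s <= be) /\
    (al = be \/ (E al /\ E be)).
Proof.
move=> h0 E.
have [[s0 Es0]|nE] := classic (exists s, E s); last first.
  exists 0, 0; split; first lra; split; first lra; split; last by left.
  by move=> s Es; case: nE; exists s.
have E_closed t : (forall e, 0 < e -> exists s, E s /\ Rabs (s - t) < e) -> E t.
  move=> Ht; split.
    split; apply: Rnot_lt_le => lt.
      by have [s [[sh _]]] := Ht (- t) ltac:(lra); move=> /Rabs_def2; lra.
    by have [s [[sh _]]] := Ht (t - h) ltac:(lra); move=> /Rabs_def2; lra.
  have close e i : 0 < e -> exists s, E s /\ Rabs (s * v i - t * v i) < e.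
    move=> e0; have v0 := Rabs_pos (v i).
    have [s [Es st]] := Ht (e / (Rabs (v i) + 1)) ltac:(apply: Rdiv_lt_0_compat; lra).
    exists s; split=> //; rewrite -Rmult_minus_distr_r Rabs_mult.
    have -> : e = e / (Rabs (v i) + 1) * (Rabs (v i) + 1) by field; lra.
    have := Rabs_pos (s - t); nra.
  move=> i; split; apply: Rnot_lt_le => lt.
    have [s [[_ /(_ i) sE]]] := close (a i - (p i + t * v i)) i ltac:(lra).
    by move=> /Rabs_def2; lra.
  have [s [[_ /(_ i) sE]]] := close (p i + t * v i - b i) i ltac:(lra).
  by move=> /Rabs_def2; lra.
have [||be beE] := completeness E; [by exists h => t [] []|by exists s0|].
have [||na naE] := completeness (fun t => E (- t)); [by exists 0 => t [] []; lra|by exists (- s0); rewrite Ropp_involutive|].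
have Ebe : E be.
  apply: E_closed => e e0; have [t [Et te]] := lub_approach _ _ _ beE e0.
  by exists t; split=> //; apply: Rabs_def1; lra.
have Eal : E (- na).
  apply: E_closed => e e0; have [t [Et te]] := lub_approach _ _ _ naE e0.
  by exists (- t); split=> //; apply: Rabs_def1; lra.
have lo s : E s -> - na <= s.
  move=> Es; have : - s <= na; last lra.
  by apply: (proj1 naE); rewrite Ropp_involutive.
exists (- na), be; split; last split; last split; last by right.
- by split; [case: Eal; lra | apply: lo].
- by case: Ebe; lra.
- by move=> s Es; split; [apply: lo | apply: (proj1 beE)].
Qed.

Lemma affine_between (a b p w al be s : R) : al <= s <= be ->
  a <= p + al * w <= b -> a <= p + be * w <= b -> a <= p + s * w <= b.
Proof. by move=> *; case: (Rle_dec 0 w) => ?; nra. Qed.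

Lemma pos_below (th : nat -> R) K : (forall m, 0 < th m) ->
  exists rho, 0 < rho /\ forall m, (m <= K)%coq_nat -> rho <= th m.
Proof.
move=> th0; elim: K => [|K [rho [r0 Hr]]].
  exists (th 0%N); split=> // m m0; have -> : m = 0%N by lia.
  exact: Rle_refl.
exists (Rmin rho (th (S K))); split; first exact: Rmin_glb_lt.
move=> m mK; have [->|mK'] : m = S K \/ (m <= K)%coq_nat by lia.
  exact: Rmin_r.
by apply: Rle_trans (Rmin_l _ _) _; apply: Hr.
Qed.

Lemma nat_above (A B : R) : 0 < B -> exists M, (0 < M)%N /\ A / INR M <= B.
Proof.
move=> B0; have [M HM] := INR_unbounded (Rmax 1 (A / B)).
have M1 := Rmax_l 1 (A / B); have M2 := Rmax_r 1 (A / B).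
exists M; split; first by apply/ltP; apply: INR_lt; rewrite /=; lra.
have -> : B = (B * INR M) / INR M by field; lra.
apply: Rmult_le_compat_r; first by left; apply: Rinv_0_lt_compat; lra.
have -> : A = B * (A / B) by field; lra.
by apply: Rmult_le_compat_l; lra.
Qed.

(* Substitute for Fubini's theorem along the direction [v]. *)
Lemma nullset_line_select (n : nat) (N : vec n -> Prop) (x v : vec n) (h delta eps : R) :
  nullset N -> 0 < h -> 0 < delta -> 0 < eps ->
  exists y : vec n, (forall i, 0 <= y i <= delta) /\
    exists l r : nat -> R, (forall m, l m <= r m) /\
      (forall s, 0 <= s <= h -> N (fun i => x i + y i + s * v i) -> exists m, l m <= s <= r m) /\
      (forall K, sum_f_R0 (fun m => r m - l m) K <= eps).
Proof.
move=> nN h0 d0 e0.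
have dn : 0 < delta ^ n by apply: pow_lt.
(* The widened boxes will have total volume at most [2 * e1]; after the averaging this becomes
   [h / delta ^ n * (2 * e1) = eps / 2]. *)
pose e1 := eps * delta ^ n / (4 * h).
have e10 : 0 < e1 by apply: Rdiv_lt_0_compat; [apply: Rmult_lt_0_compat | lra].
have [a [b [ab [cov sm]]]] := nN e1 e10.
have half0 m : 0 < e1 * (/ 2) ^ S m by apply: Rmult_lt_0_compat => //; apply: pow_lt; lra.
have /choice [th Hth] : forall m, exists t, 0 < t /\
    prodR (fun i => (b m i - a m i) + 3 * t) <= boxvol (a m) (b m) + e1 * (/ 2) ^ S m.
  by move=> m; apply: prodR_perturb.
have th0 m := proj1 (Hth m).
have sum_th K : sum_f_R0 (fun m => prodR (fun i => (b m i - a m i) + 3 * th m)) K <= 2 * e1.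
  apply: (Rle_trans _ (sum_f_R0 (fun m => boxvol (a m) (b m) + (/ 2) ^ S m * e1) K)).
    by apply: sum_f_R0_mono => m; have := proj2 (Hth m); lra.
  rewrite sum_plus -scal_sum; have := sm K; have := sum_half_pow K; nra.
(* The widening keeps the counts valid after passing from an approximating translate to the cluster
   point. *)
pose a' m : vec n := fun i => a m i - th m; pose b' m : vec n := fun i => b m i + th m.
pose s_ P (j : 'I_P) := h / INR P * INR j.
pose pt P (j : 'I_P) : vec n := fun i => x i + s_ P j * v i.
(* For the first [K + 1] boxes: a number [Q.1] of sample points on the segment and a translation
   [Q.2] for which few samples meet the widened boxes. The spacing [h / Q.1] is so fine that one
   spacing lost per box costs at most [eps / 2] in total. *)
have /choice [Q HQ] : forall K, exists Q : nat * vec n,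
    (0 < Q.1)%N /\ h * INR (S K) / INR Q.1 <= eps / 2 /\
    (forall i, 0 <= Q.2 i <= delta) /\
    h / INR Q.1 * \big[Rplus/R0]_(m < K.+1) \big[Rplus/R0]_(j < Q.1)
        indic (in_box (a' m) (b' m) (vadd (pt _ j) Q.2)) <= eps / 2.
  move=> K.
  have [P [P0 HP]] := nat_above (h * INR (S K)) (eps / 2) ltac:(lra).
  have [rho [rho0 Hrho]] := pos_below th K th0.
  have [M [M0 HM]] := nat_above delta rho rho0.
  have ab' m i : a' m i <= b' m i by rewrite /a' /b'; have := ab m i; have := th0 m; lra.
  have [y [yd Hy]] := grid_translate n M P K.+1 (pt P) a' b' delta d0 M0 ab'.
  exists (P, y) => /=; split=> //; split=> //; split=> //.
  have P1 : 0 < INR P by apply: lt_0_INR; apply/ltP.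
  set S := (X in _ * X <= _); rewrite -/S in Hy.
  have le : \big[Rplus/R0]_(m < K.+1) prodR (fun i => b' m i - a' m i + delta / INR M) <= 2 * e1.
    apply: Rle_trans (sum_th K); rewrite sum_f_R0_big; apply: bigR_le => m _.
    apply: bigprodR_le => i; have := Hrho m ltac:(apply/leP; rewrite -ltnS; apply: ltn_ord).
    have : 0 < delta / INR M by apply: Rdiv_lt_0_compat => //; apply: lt_0_INR; apply/ltP.
    by rewrite /a' /b'; have := ab m i; have := th0 m; lra.
  have {}Hy : delta ^ n * S <= INR P * (2 * e1).
    by apply: Rle_trans Hy _; apply: Rmult_le_compat_l => //; lra.
  have -> : eps / 2 = h / INR P / delta ^ n * (INR P * (2 * e1)) by rewrite /e1; field; lra.
  have -> : h / INR P * S = h / INR P / delta ^ n * (delta ^ n * S) by field; lra.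
  apply: Rmult_le_compat_l => //; left; do 2!apply: Rdiv_lt_0_compat => //.
have [y Hy] := cluster_point n (fun K => (Q K).2) delta (fun K => proj1 (proj2 (proj2 (HQ K)))).
exists y; split.
  move=> i; split; apply: Rnot_lt_le => lt.
    have [k [_ /(_ i)]] := Hy (- y i) 0%N ltac:(lra).
    have [_ [_ [/(_ i)]]] := HQ k.
    by move=> ? _ /Rabs_def2; lra.
  have [k [_ /(_ i)]] := Hy (y i - delta) 0%N ltac:(lra).
  have [_ [_ [/(_ i)]]] := HQ k.
  by move=> ? _ /Rabs_def2; lra.
have /choice [lr Hlr] : forall m, exists w : R * R, 0 <= w.1 <= w.2 /\ w.2 <= h /\
    (forall s, 0 <= s <= h -> in_box (a m) (b m) (fun i => x i + y i + s * v i) -> w.1 <= s <= w.2) /\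
    (w.1 = w.2 \/ in_box (a m) (b m) (fun i => x i + y i + w.1 * v i) /\
                  in_box (a m) (b m) (fun i => x i + y i + w.2 * v i)).
  move=> m.
  have [al [be [H1 [H2 [H3 H4]]]]] := segment_box n (fun i => x i + y i) v (a m) (b m) h h0.
  exists (al, be) => /=; split=> //; split=> //; split; first by move=> s sh sE; apply: H3.
  by case: H4 => [->|[[_ Ea] [_ Eb]]]; [left | right].
exists (fun m => (lr m).1), (fun m => (lr m).2); split; first by move=> m; case: (Hlr m); lra.
split.
  move=> s sh /cov [m Hm]; exists m.
  by have [_ [_ [H _]]] := Hlr m; apply: H.
(* To bound the first [K0 + 1] lengths, take a translate of index [K >= K0] that is closer to [y]
   than the widening of these boxes. A sample point between the two ends lies in the box by
   convexity, and its nearby translate lies in the widened box. *)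
move=> K0; have [rho [rho0 Hrho]] := pos_below th K0 th0.
have [K [K0K Hclose]] := Hy rho K0 rho0.
have [P0 [HP [_ HS]]] := HQ K.
move: (Q K) P0 HP HS Hclose => [P yK] /= P0 HP HS Hclose.
have P1 : 0 < INR P by apply: lt_0_INR; apply/ltP.
pose c := h / INR P; have c0 : 0 < c by apply: Rdiv_lt_0_compat.
pose T m := \big[Rplus/R0]_(j < P) indic (in_box (a' m) (b' m) (vadd (pt P j) yK)).
have T0 m : 0 <= T m by apply: bigR_ge0 => j _; apply: indic_ge0.
have main m : (m <= K0)%coq_nat -> (lr m).2 - (lr m).1 <= c + T m * c.
  move=> mK0; have [H1 [H2 [_ [eq|[Ea Eb]]]]] := Hlr m.
    by rewrite eq; have := Rmult_le_pos _ _ (T0 m) (Rlt_le _ _ c0); lra.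
  have cP : c * INR P = h by rewrite /c; field; lra.
  have := grid_count_ge (lr m).1 (lr m).2 c P ltac:(lra) c0 ltac:(lra).
  have : (\big[Rplus/R0]_(k < P) indic ((lr m).1 <= c * INR k <= (lr m).2)) <= T m.
    apply: bigR_le => j _; apply: indic_le => sj i.
    have := affine_between _ _ _ _ _ _ _ sj (Ea i) (Eb i).
    rewrite /vadd /pt /s_ -/c /a' /b'; have := Hrho m mK0; have /Rabs_def2 := Hclose i; lra.
  by move=> H; have := Rmult_le_compat_r c _ _ ltac:(lra) H; lra.
have : sum_f_R0 (fun m => (lr m).2 - (lr m).1) K0 <= sum_f_R0 (fun m => c + T m * c) K0.
  by apply: sum_Rle => m /main.
have cT m : 0 <= c + T m * c by have := Rmult_le_pos _ _ (T0 m) (Rlt_le _ _ c0); lra.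
(* The counting bound is known for [K + 1] boxes, so the nonnegative terms are added up to [K]. *)
have := sum_f_R0_extend (fun m => c + T m * c) K0 K cT K0K.
rewrite !sum_plus !sum_cte -!scal_sum.
have {}HS : c * sum_f_R0 T K <= eps / 2 by rewrite sum_f_R0_big.
rewrite (_ : h * INR (S K) / INR P = c * INR (S K)) in HP; last by rewrite /c; field; lra.
lra.
Qed.

(** * Minors and their differential *)

Section Minors.
Local Open Scope ring_scope.
Variables (F : comNzRingType) (n q p : nat).
Implicit Types (G : 'M[F]_(n, q)) (J : {ffun 'I_p -> 'I_n}) (I : {ffun 'I_p -> 'I_q}).

(** The index maps are arbitrary rather than increasing, so the family of minors is closed under
    replacing one index; maps with a repeated value only contribute zeros. *)
Definition minor G J I : F := \det (mxsub J I G).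

Definition ffun_upd (k : nat) (f : {ffun 'I_p -> 'I_k}) (s : 'I_p) (b : 'I_k) :
  {ffun 'I_p -> 'I_k} := [ffun i => if i == s then b else f i].

(* Differential of the determinant at [A] in the direction [X]. *)
Definition ddet (A X : 'M[F]_p) : F := \sum_s \sum_r X s r * cofactor A s r.

Lemma ddetD A X Y : ddet A (X + Y) = ddet A X + ddet A Y.
Proof.
rewrite /ddet -big_split; apply: eq_bigr => s _; rewrite -big_split.
by apply: eq_bigr => r _; rewrite mxE mulrDl.
Qed.

Lemma cofactor_upd_row G J I s b r :
  cofactor (mxsub (ffun_upd _ J s b) I G) s r = cofactor (mxsub J I G) s r.
Proof.
congr (_ * \det _); apply/matrixP => i j; rewrite !mxE ffunE.
by rewrite eq_sym (negbTE (neq_lift s i)).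
Qed.

Lemma cofactor_upd_col G J I s l r :
  cofactor (mxsub J (ffun_upd _ I r l) G) s r = cofactor (mxsub J I G) s r.
Proof.
congr (_ * \det _); apply/matrixP => i j; rewrite !mxE ffunE.
by rewrite eq_sym (negbTE (neq_lift r j)).
Qed.

(** Row [J s] of [B *m G] is a combination of rows of [G], and the cofactors along row [s] do not
    see that row; each term is therefore a Laplace expansion of a minor with its [s]-th row index
    replaced. *)
Lemma ddet_mull (B : 'M[F]_n) G J I :
  ddet (mxsub J I G) (mxsub J I (B *m G))
  = \sum_s \sum_b B (J s) b * minor G (ffun_upd _ J s b) I.
Proof.
apply: eq_bigr => s _.
under eq_bigr do rewrite !mxE big_distrl /=.
rewrite exchange_big; apply: eq_bigr => b _ /=.
rewrite /minor (expand_det_row _ s) big_distrr; apply: eq_bigr => r _ /=.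
by rewrite cofactor_upd_row !mxE ffunE eqxx -mulrA.
Qed.

Lemma ddet_mulr (C : 'M[F]_q) G J I :
  ddet (mxsub J I G) (mxsub J I (G *m C))
  = \sum_r \sum_l C l (I r) * minor G J (ffun_upd _ I r l).
Proof.
rewrite /ddet exchange_big; apply: eq_bigr => r _.
under eq_bigr do rewrite !mxE big_distrl /=.
rewrite exchange_big; apply: eq_bigr => l _ /=.
rewrite /minor (expand_det_col _ r) big_distrr; apply: eq_bigr => s _ /=.
by rewrite cofactor_upd_col !mxE ffunE eqxx -mulrA mulrCA.
Qed.

(** The inner sum for fixed [s] is the determinant of [A] with row [s] taken from [X]. The
    right-hand side is what the product rule yields from the Leibniz formula, as used in
    [derivable_pt_lim_det]. *)
Lemma ddet_leibniz (A X : 'M[F]_p) :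
  ddet A X = \sum_(sg : 'S_p) (-1) ^+ sg *
    \sum_s \prod_i (if i == s then X i (sg i) else A i (sg i)).
Proof.
under [RHS]eq_bigr do rewrite big_distrr /=.
rewrite exchange_big; apply: eq_bigr => s _ /=.
pose A' := \matrix_(i, j) if i == s then X i j else A i j.
have -> : \sum_r X s r * cofactor A s r = \det A'.
  rewrite (expand_det_row _ s); apply: eq_bigr => r _; rewrite mxE eqxx.
  congr (_ * (_ * \det _)); apply/matrixP => i j; rewrite !mxE.
  by rewrite eq_sym (negbTE (neq_lift s i)).
by apply: eq_bigr => sg _; congr (_ * _); apply: eq_bigr => i _; rewrite mxE.
Qed.

End Minors.

(** * Rank and nonvanishing minors *)

Section MinorRank.
Local Open Scope ring_scope.
Variables (F : fieldType) (n q p : nat).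

Lemma row_free_widen (r m : nat) (M : 'M[F]_(r, m)) (pr : (p <= r)%N) :
  row_free M -> row_free (rowsub (widen_ord pr) M).
Proof.
move=> /row_freeP [N MN]; apply/row_freeP; exists (N *m colsub (widen_ord pr) 1%:M).
rewrite rowsubE mulmxA -(mulmxA _ M) MN mulmx1 -rowsubE.
by apply/matrixP => i j; rewrite !mxE.
Qed.

(** If the rank is at least [p], choose [p] independent rows, then [p] columns on which these rows
    form an invertible block. Conversely, an invertible block has rank [p], and passing to a
    submatrix cannot raise the rank. *)
Lemma minor_neq0 (G : 'M[F]_(n, q)) :
  (p <= \rank G)%N <-> exists J I, @minor F n q p G J I != 0.
Proof.
split=> [pr|[J [I]]]; last first.
  rewrite -unitfE => /(@mxrank_unit F p (mxsub J I G)) <-.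
  rewrite mxsubrc rowsubE; apply: leq_trans (mxrankM_maxr _ _) _.
  by rewrite -mxrank_tr trmx_mxsub -(mxrank_tr G); apply: mxrankS; apply: rowsub_sub.
have fr := row_free_widen _ _ _ pr (maxrowsub_free G).
rewrite -rowsub_comp in fr; set f := _ \o _ in fr.
have fu : row_full (rowsub f G)^T by rewrite /row_full mxrank_tr.
exists (finfun f), (fullrankfun fu); rewrite -unitfE.
have -> : minor _ _ _ _ G (finfun f) (fullrankfun fu)
    = \det (rowsub (fullrankfun fu) (rowsub f G)^T)^T.
  by congr (\det _); apply/matrixP => i j; rewrite !mxE ffunE.
by rewrite -unitmxE unitmx_tr; apply: fullrowsub_unit.
Qed.

End MinorRank.

(** * Derivatives and Lipschitz bounds of determinants *)

Lemma derivable_pt_lim_big_sum (T : Type) (r : seq T) (f : T -> R -> R) (d : T -> R) t :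
  (forall i, derivable_pt_lim (f i) t (d i)) ->
  derivable_pt_lim (fun s => \big[Rplus/R0]_(i <- r) f i s) t (\big[Rplus/R0]_(i <- r) d i).
Proof.
move=> H; elim: r => [|i r IH].
  rewrite big_nil; under eq_fun do rewrite big_nil; exact: (derivable_pt_lim_const R0).
rewrite big_cons; under eq_fun do rewrite big_cons.
exact: (derivable_pt_lim_plus (f i) (fun s => \big[Rplus/R0]_(i <- r) f i s)).
Qed.

Lemma derivable_pt_lim_big_prod (T : eqType) (r : seq T) (f : T -> R -> R) (d : T -> R) t :
  uniq r -> (forall i, derivable_pt_lim (f i) t (d i)) ->
  derivable_pt_lim (fun s => \big[Rmult/R1]_(i <- r) f i s) t
    (\big[Rplus/R0]_(k <- r) \big[Rmult/R1]_(i <- r) (if i == k then d i else f i t)).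
Proof.
move=> ur H; elim: r ur => [_|i r IH /= /andP [ir ur]].
  rewrite big_nil; under eq_fun do rewrite big_nil; exact: (derivable_pt_lim_const R1).
under eq_fun do rewrite big_cons.
rewrite big_cons big_cons eqxx.
have -> : \big[Rmult/R1]_(j <- r) (if j == i then d j else f j t) = \big[Rmult/R1]_(j <- r) f j t.
  rewrite !big_seq; apply: eq_bigr => j jr; case: eqP => // ji.
  by rewrite ji in jr; rewrite jr in ir.
have -> : \big[Rplus/R0]_(k <- r) \big[Rmult/R1]_(j <- i :: r) (if j == k then d j else f j t)
   = f i t * \big[Rplus/R0]_(k <- r) \big[Rmult/R1]_(j <- r) (if j == k then d j else f j t).
  rewrite big_distrr !big_seq; apply: eq_bigr => k kr; rewrite big_cons; case: eqP => // ki.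
  by rewrite -ki in kr; rewrite kr in ir.
apply: (derivable_pt_lim_mult (f i) (fun s => \big[Rmult/R1]_(i <- r) f i s)); [exact: H | exact: IH].
Qed.

Lemma derivable_pt_lim_det (p : nat) (A : R -> 'M[R]_p) (X : 'M[R]_p) t :
  (forall i j, derivable_pt_lim (fun s => A s i j) t (X i j)) ->
  derivable_pt_lim (fun s => determinant (A s)) t (ddet R p (A t) X).
Proof.
move=> H; rewrite ddet_leibniz; apply: derivable_pt_lim_big_sum => sg.
apply: (derivable_pt_lim_scal (fun s => \big[Rmult/R1]_i A s i (sg i))).
apply: (derivable_pt_lim_big_prod _ _ (fun i s => A s i (sg i)) (fun i => X i (sg i))) => //.
exact: index_enum_uniq.
Qed.

(** Boundedness is included because it makes the class stable under products, hence under
    determinants and cofactors. *)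
Definition bdd_lip {T : Type} (D : T -> Prop) (dist : T -> T -> R) (f : T -> R) : Prop :=
  exists K, 0 <= K /\ (forall x, D x -> Rabs (f x) <= K) /\
    forall x y, D x -> D y -> Rabs (f x - f y) <= K * dist x y.

Section Blip.
Variables (T : Type) (D : T -> Prop) (dist : T -> T -> R).
Hypothesis dist_ge0 : forall x y, 0 <= dist x y.

Lemma bdd_lip_const c : bdd_lip D dist (fun _ => c).
Proof.
exists (Rabs c); split; first exact: Rabs_pos.
split=> [x _|x y _ _]; first lra.
by rewrite Rminus_diag Rabs_R0; apply: Rmult_le_pos => //; apply: Rabs_pos.
Qed.

Lemma bdd_lip_add f g : bdd_lip D dist f -> bdd_lip D dist g -> bdd_lip D dist (fun x => f x + g x).
Proof.
move=> [K [K0 [fb fl]]] [L [L0 [gb gl]]]; exists (K + L); split; first lra; split.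
  by move=> x Dx; have := Rabs_triang (f x) (g x); have := fb x Dx; have := gb x Dx; lra.
move=> x y Dx Dy; rewrite (_ : f x + g x - (f y + g y) = (f x - f y) + (g x - g y)); last ring.
have := Rabs_triang (f x - f y) (g x - g y); have := fl x y Dx Dy; have := gl x y Dx Dy; lra.
Qed.

Lemma bdd_lip_mul f g : bdd_lip D dist f -> bdd_lip D dist g -> bdd_lip D dist (fun x => f x * g x).
Proof.
move=> [K [K0 [fb fl]]] [L [L0 [gb gl]]]; exists (2 * (K * L)).
have KL := Rmult_le_pos _ _ K0 L0.
split; first lra; split.
  move=> x Dx; rewrite Rabs_mult.
  have := Rmult_le_compat _ _ _ _ (Rabs_pos _) (Rabs_pos _) (fb x Dx) (gb x Dx); lra.
move=> x y Dx Dy.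
rewrite (_ : f x * g x - f y * g y = (f x - f y) * g x + f y * (g x - g y)); last ring.
have := Rabs_triang ((f x - f y) * g x) (f y * (g x - g y)); rewrite !Rabs_mult.
have := Rmult_le_compat _ _ _ _ (Rabs_pos _) (Rabs_pos _) (fl x y Dx Dy) (gb x Dx).
have := Rmult_le_compat _ _ _ _ (Rabs_pos _) (Rabs_pos _) (fb y Dy) (gl x y Dx Dy).
lra.
Qed.

Lemma bdd_lip_big_sum (I : Type) (r : seq I) (f : I -> T -> R) :
  (forall i, bdd_lip D dist (f i)) -> bdd_lip D dist (fun x => \big[Rplus/R0]_(i <- r) f i x).
Proof.
move=> H; elim: r => [|i r IH].
  by under eq_fun do rewrite big_nil; apply: bdd_lip_const.
by under eq_fun do rewrite big_cons; apply: bdd_lip_add.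
Qed.

Lemma bdd_lip_big_prod (I : Type) (r : seq I) (f : I -> T -> R) :
  (forall i, bdd_lip D dist (f i)) -> bdd_lip D dist (fun x => \big[Rmult/R1]_(i <- r) f i x).
Proof.
move=> H; elim: r => [|i r IH].
  by under eq_fun do rewrite big_nil; apply: bdd_lip_const.
by under eq_fun do rewrite big_cons; apply: bdd_lip_mul.
Qed.

Lemma bdd_lip_det (p : nat) (A : T -> 'M[R]_p) :
  (forall i j, bdd_lip D dist (fun x => A x i j)) -> bdd_lip D dist (fun x => determinant (A x)).
Proof.
move=> H; apply: bdd_lip_big_sum => sg; apply: bdd_lip_mul; first exact: bdd_lip_const.
by apply: (bdd_lip_big_prod _ _ (fun i x => A x i (sg i))) => i; apply: H.
Qed.

Lemma bdd_lip_cofactor (p : nat) (A : T -> 'M[R]_p) s r :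
  (forall i j, bdd_lip D dist (fun x => A x i j)) -> bdd_lip D dist (fun x => cofactor (A x) s r).
Proof.
move=> H; apply: bdd_lip_mul; first exact: bdd_lip_const.
apply: bdd_lip_det => i j.
rewrite (_ : (fun x => _) = (fun x => A x (lift s i) (lift r j))) //.
by apply: funext => x; rewrite !mxE.
Qed.

End Blip.

(** * Lipschitz functions of several variables *)

Lemma Rabs_le_between a b : Rabs a <= b -> - b <= a <= b.
Proof. by move=> H; have := Rle_abs a; have := Rle_abs (- a); rewrite Rabs_Ropp; lra. Qed.

Lemma bigR_abs_le (T : finType) (f : T -> R) c :
  (forall i, Rabs (f i) <= c) -> Rabs (\big[Rplus/R0]_(i : T) f i) <= INR #|T| * c.
Proof.
move=> H; apply: Rle_trans (bigR_abs _ _ _) _; rewrite -bigR_const.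
by apply: bigR_le.
Qed.

Lemma finite_upper_bound (T : finType) (P : T -> R -> Prop) :
  (forall i r r', r <= r' -> P i r -> P i r') -> (forall i, exists r, P i r) ->
  exists r, 0 <= r /\ forall i, P i r.
Proof.
move=> mono /choice [b Hb]; exists (\big[Rplus/R0]_(i : T) Rabs (b i)); split.
  by apply: bigR_ge0 => i _; apply: Rabs_pos.
move=> i; apply: mono (Hb i); apply: Rle_trans (Rle_abs _) _.
by apply: (bigR_term_le _ (fun i => Rabs (b i))) => j; apply: Rabs_pos.
Qed.

Lemma finite_pos_lower_bound (T : finType) (P : T -> R -> Prop) :
  (forall i r r', 0 < r' <= r -> P i r -> P i r') ->
  (forall i, exists r, 0 < r /\ P i r) -> exists r, 0 < r /\ forall i, P i r.
Proof.
move=> mono H.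
(* [B] plays the role of [1 / r], which turns a positive lower bound into an upper bound. *)
have [|i|b [b0 Hb]] := finite_upper_bound T (fun i B => forall r, 0 < r -> r * B <= 1 -> P i r).
- by move=> i B B' BB' HB r r0 rB; apply: HB => //; nra.
- have [r [r0 Pr]] := H i; exists (/ r) => r' r'0 le; apply: mono Pr; split=> //.
  have : r' * / r * r <= 1 * r by apply: Rmult_le_compat_r; lra.
  by rewrite Rmult_assoc Rinv_l; lra.
exists (/ (b + 1)); split; first by apply: Rinv_0_lt_compat; lra.
move=> i; apply: Hb; first by apply: Rinv_0_lt_compat; lra.
rewrite -[X in _ <= X](Rinv_l (b + 1)); last lra.
by apply: Rmult_le_compat_l; [left; apply: Rinv_0_lt_compat; lra | lra].
Qed.

Lemma vnorm_sqr n (v : vec n) : vnorm v * vnorm v = sumR (fun i => v i * v i).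
Proof. by apply: sqrt_sqrt; apply: bigR_ge0 => i _; nra. Qed.

Lemma Rabs_coord_le_vnorm n (v : vec n) i : Rabs (v i) <= vnorm v.
Proof.
apply: Rsqr_incr_0_var; last exact: sqrt_pos.
rewrite -Rsqr_abs /Rsqr vnorm_sqr.
by apply: (bigR_term_le _ (fun i => v i * v i)) => j; nra.
Qed.

Definition norm1 {n} (v : vec n) : R := sumR (fun i => Rabs (v i)).
Definition dist1 {n} (x y : vec n) : R := sumR (fun i => Rabs (x i - y i)).

Lemma norm1_ge0 n (v : vec n) : 0 <= norm1 v.
Proof. by apply: bigR_ge0 => i _; apply: Rabs_pos. Qed.

Lemma dist1_ge0 n (x y : vec n) : 0 <= dist1 x y.
Proof. by apply: bigR_ge0 => i _; apply: Rabs_pos. Qed.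

Lemma vnorm_le_norm1 n (v : vec n) : vnorm v <= norm1 v.
Proof.
apply: Rsqr_incr_0_var; last exact: norm1_ge0.
rewrite /Rsqr vnorm_sqr.
have : 0 <= norm1 v /\ sumR (fun i => v i * v i) <= norm1 v * norm1 v; last by case.
apply: (big_ind2 (fun x y => 0 <= y /\ x <= y * y)).
- by split; nra.
- by move=> x1 x2 y1 y2 [? ?] [? ?]; split; nra.
- move=> i _; split; first exact: Rabs_pos.
  by have := Rsqr_abs (v i); rewrite /Rsqr; lra.
Qed.

Lemma norm1_le n (v : vec n) c : (forall i, Rabs (v i) <= c) -> norm1 v <= INR n * c.
Proof.
by move=> H; rewrite -[X in INR X](card_ord n) -bigR_const; apply: bigR_le => i _.
Qed.

Lemma dist1_le n (x y : vec n) c : (forall i, Rabs (x i - y i) <= c) -> dist1 x y <= INR n * c.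
Proof. exact: (norm1_le n (vsub x y)). Qed.

Definition cube {n} (c : vec n) (r : R) (z : vec n) : Prop := forall i, Rabs (z i - c i) < r.

Lemma cube_margin n (c x : vec n) r : cube c r x ->
  exists mu, 0 < mu /\ forall z, (forall i, Rabs (z i - x i) < mu) -> cube c r z.
Proof.
move=> xc.
have [||mu [mu0 Hmu]] := finite_pos_lower_bound _
    (fun (i : 'I_n) mu => forall a, Rabs (a - x i) < mu -> Rabs (a - c i) < r).
- by move=> i r1 r2 le H a Ha; apply: H; lra.
- move=> i; exists (r - Rabs (x i - c i)); split; first by have := xc i; lra.
  move=> a Ha; have := Rabs_triang (a - x i) (x i - c i).
  by rewrite (_ : a - x i + (x i - c i) = a - c i); [lra | ring].
by exists mu; split=> // z Hz i; apply: Hmu.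
Qed.

Lemma cube_open n (c : vec n) r : is_open (cube c r).
Proof.
move=> x /cube_margin [mu [mu0 Hmu]]; exists mu; split=> // y yx; apply: Hmu => i.
exact: Rle_lt_trans (Rabs_coord_le_vnorm _ (vsub y x) i) yx.
Qed.

Lemma cube_bounded n (c : vec n) r : is_bounded (cube c r).
Proof.
exists (INR n * (norm1 c + r)) => x xc; apply: Rle_trans (vnorm_le_norm1 _ _) _.
apply: norm1_le => i; have := Rabs_triang (x i - c i) (c i); have := xc i.
have : Rabs (c i) <= norm1 c := bigR_term_le _ (fun i => Rabs (c i)) i (fun j => Rabs_pos _).
by rewrite (_ : x i - c i + c i = x i); [lra | ring].
Qed.

Lemma bdd_lip_subset {T : Type} (D D' : T -> Prop) dist f :
  (forall x, D' x -> D x) -> bdd_lip D dist f -> bdd_lip D' dist f.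
Proof.
move=> sub [K [K0 [b l]]]; exists K; split=> //; split=> [x /sub|x y /sub Dx /sub Dy]; [exact: b|exact: l].
Qed.

Lemma cube_ball n (c z : vec n) delta : 0 < delta ->
  cube c (delta / (INR n + 1)) z -> vnorm (vsub z c) < delta.
Proof.
move=> d0 zc; apply: Rle_lt_trans (vnorm_le_norm1 _ _) _.
have n0 := pos_INR n.
have r0 : 0 < delta / (INR n + 1) by apply: Rdiv_lt_0_compat; lra.
apply: Rle_lt_trans (norm1_le _ _ (delta / (INR n + 1)) _) _.
  by move=> i; left; apply: zc.
have {2}-> : delta = (INR n + 1) * (delta / (INR n + 1)) by field; lra.
by apply: Rmult_lt_compat_r; lra.
Qed.

Lemma locally_lipschitz_bdd_lip n (f : vec n -> vec n) (c : vec n) :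
  locally_lipschitz f -> exists r, 0 < r /\ forall i, bdd_lip (cube c r) dist1 (fun z => f z i).
Proof.
move=> /(_ c) [d [d0 [L HL]]]; have n0 := pos_INR n.
have L0 : 0 <= Rabs L := Rabs_pos L.
pose r := d / (INR n + 1); have r0 : 0 < r by apply: Rdiv_lt_0_compat; lra.
have lip y z : cube c r y -> cube c r z -> forall i, Rabs (f y i - f z i) <= Rabs L * dist1 y z.
  move=> yc zc i; apply: Rle_trans (Rabs_coord_le_vnorm _ (vsub (f y) (f z)) i) _.
  apply: Rle_trans (HL y z (cube_ball _ _ _ _ d0 yc) (cube_ball _ _ _ _ d0 zc)) _.
  apply: Rle_trans (Rmult_le_compat_r _ _ _ (sqrt_pos _) (Rle_abs L)) _.
  by apply: Rmult_le_compat_l => //; apply: (vnorm_le_norm1 _ (vsub y z)).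
have cc : cube c r c by move=> i; rewrite Rminus_diag Rabs_R0.
(* One constant serves both as Lipschitz constant and as bound: the bracket is the oscillation over
   the cube plus the value at the centre. *)
exists r; split=> // i; exists (Rabs L + (Rabs L * (INR n * r) + Rabs (f c i))).
have Lr : 0 <= Rabs L * (INR n * r) by apply: Rmult_le_pos => //; apply: Rmult_le_pos; lra.
have fc := Rabs_pos (f c i).
split; first lra; split.
  move=> z zc; have := lip z c zc cc i.
  have : Rabs L * dist1 z c <= Rabs L * (INR n * r).
    by apply: Rmult_le_compat_l => //; apply: dist1_le => k; left; apply: zc.
  have := Rabs_triang (f z i - f c i) (f c i).
  by rewrite (_ : f z i - f c i + f c i = f z i); [lra | ring].
move=> y z yc zc; apply: Rle_trans (lip y z yc zc i) _.
by apply: Rmult_le_compat_r; [apply: dist1_ge0 | lra].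
Qed.

Lemma derivable_pt_lim_right_dini (f : R -> R) t b d beta :
  derivable_pt_lim f t d -> d <= beta ->
  right_dini_nonpos (fun s => f s - beta * s) b t.
Proof.
move=> fd db eta eta0; have [dl Hdl] := fd eta eta0.
exists dl; split; first exact: cond_pos.
move=> h h0 _; have := Hdl h ltac:(lra) ltac:(rewrite Rabs_pos_eq; lra).
move=> /Rabs_def2 [H _].
have : (f (t + h) - f t) / h * h < (d + eta) * h by apply: Rmult_lt_compat_r; lra.
have -> : (f (t + h) - f t) / h * h = f (t + h) - f t by field; lra.
nra.
Qed.

Lemma le_of_small_slack (A B C d0 : R) : 0 < d0 -> 0 <= C ->
  (forall d, 0 < d <= d0 -> A <= B + d * C) -> A <= B.
Proof.
move=> d00 C0 H; apply: Rnot_lt_le => lt.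
pose d := Rmin d0 ((A - B) / (2 * (C + 1))).
have q0 : 0 < (A - B) / (2 * (C + 1)) by apply: Rdiv_lt_0_compat; lra.
have := H d ltac:(split; [apply: Rmin_glb_lt | apply: Rmin_l] => //).
have : d * (C + 1) <= (A - B) / 2.
  have -> : (A - B) / 2 = (A - B) / (2 * (C + 1)) * (C + 1) by field; lra.
  by apply: Rmult_le_compat_r; [lra | apply: Rmin_r].
have : 0 < d by apply: Rmin_glb_lt.
nra.
Qed.

(* Translate the segment to a nearby one that meets the exceptional set in small length. *)
Lemma lipschitz_ae_direction n (D N : vec n -> Prop) (F : vec n -> R) (K beta h d0 : R) (x v : vec n) :
  0 <= K -> (forall y z, D y -> D z -> Rabs (F y - F z) <= K * dist1 y z) ->
  nullset N -> 0 < h -> 0 < d0 ->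
  (forall (y : vec n) s, (forall i, 0 <= y i <= d0) -> 0 <= s <= h ->
     let z := (fun i => x i + y i + s * v i) : vec n in
     D z /\ (~ N z -> exists d, derivable_pt_lim (fun r => F (fun i => z i + r * v i)) 0 d /\ d <= beta)) ->
  F (fun i => x i + h * v i) - F x <= beta * h.
Proof.
move=> K0 lip nN h0 d00 H.
have v0 := norm1_ge0 _ v; have n0 := pos_INR n.
pose K' := K * norm1 v + Rabs beta.
have K'0 : 0 <= K' by have := Rmult_le_pos _ _ K0 v0; have := Rabs_pos beta; rewrite /K'; lra.
have Kn0 := Rmult_le_pos _ _ K0 n0.
(* With translation and bad length both of size [d], [dini_le] costs [K' * (2 * d)] and moving each
   of the two end points costs [K * INR n * d]. *)
apply: (le_of_small_slack _ _ (2 * K' + 2 * (K * INR n)) d0) => //; first lra.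
move=> d dd0.
have [y [yd [l [r [lr [cov sm]]]]]] := nullset_line_select n N x v h d d nN h0 (proj1 dd0) (proj1 dd0).
have yd0 i : 0 <= y i <= d0 by have := yd i; lra.
pose f s := F (fun i => x i + y i + s * v i) - beta * s.
have dini : f h - f 0 <= K' * (2 * d).
  apply: (dini_le f 0 h K' d l r) => //; [lra|lra| |].
  - move=> s t sh th; rewrite /f.
    have [Ds _] := H y s yd0 sh; have [Dt _] := H y t yd0 th.
    have := lip _ _ Ds Dt.
    have -> : dist1 (fun i => x i + y i + s * v i) (fun i => x i + y i + t * v i)
        = norm1 v * Rabs (s - t).
      rewrite /dist1 /norm1 /sumR big_distrl; apply: eq_bigr => i _ /=.
      by rewrite -Rabs_mult; congr Rabs; ring.
    set A := F _; set B := F _ => AB.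
    rewrite (_ : A - beta * s - (B - beta * t) = (A - B) + - (beta * (s - t))); last ring.
    by have := Rabs_triang (A - B) (- (beta * (s - t))); rewrite Rabs_Ropp Rabs_mult /K'; lra.
  - move=> t th nt.
    have [_ [|e [Fd eb]]] := H y t yd0 ltac:(lra).
      by move=> Nt; have [m tm] := cov t ltac:(lra) Nt; apply: (nt m).
    apply: (derivable_pt_lim_right_dini _ _ _ e) => // eta eta0.
    have [dl Hdl] := Fd eta eta0; exists dl => k k0 kd; have := Hdl k k0 kd.
    have -> : (fun i => x i + y i + (t + k) * v i) = (fun i => x i + y i + t * v i + (0 + k) * v i).
      by apply: funext => i; ring.
    have -> // : (fun i => x i + y i + t * v i + 0 * v i) = (fun i => x i + y i + t * v i).
    by apply: funext => i; ring.
(* The zero translation is admissible, so the original segment also lies in [D]. *)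
have zero (i : 'I_n) : 0 <= 0 <= d0 by lra.
have Dshift s : 0 <= s <= h -> Rabs (F (fun i => x i + s * v i) - F (fun i => x i + y i + s * v i)) <= K * INR n * d.
  move=> sh; have [Ds _] := H y s yd0 sh; have [D0 _] := H (fun _ => 0) s zero sh.
  have E : (fun i => x i + 0 + s * v i) = (fun i => x i + s * v i) by apply: funext => i; ring.
  move: D0; rewrite /= E => D0; apply: Rle_trans (lip _ _ D0 Ds) _.
  rewrite Rmult_assoc; apply: Rmult_le_compat_l => //; apply: dist1_le => i.
  rewrite (_ : _ - _ = - y i); last ring.
  by rewrite Rabs_Ropp Rabs_pos_eq; have := yd i; lra.
have := Dshift h ltac:(lra); have := Dshift 0 ltac:(lra).
have -> : (fun i => x i + 0 * v i) = x by apply: funext => i; ring.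
move: dini; rewrite /f; set A := F _; set B := F _ => ? /Rabs_le_between ? /Rabs_le_between ?.
lra.
Qed.

(** * Independence in the span of the fields, read off from minors *)

Definition fields_mx {q n} (g : 'I_q -> vec n -> vec n) (z : vec n) : 'M[R]_(n, q) :=
  \matrix_(i, k) g k z i.

Definition has_indep {q n} (g : 'I_q -> vec n -> vec n) (x : vec n) (p : nat) : Prop :=
  exists w : 'I_p -> vec n, (forall i, inP g x (w i)) /\ lin_indep w.

Section HasIndep.
Local Open Scope ring_scope.

Lemma has_indepP q n (g : 'I_q -> vec n -> vec n) x p :
  has_indep g x p <-> exists J I, minor R n q p (fields_mx g x) J I <> R0.
Proof.
split=> [[w [wP wfree]]|[J [I nz]]].
  have [c Hc] := choice wP.
  have [|J [I nz]] := (minor_neq0 R n q p (fields_mx g x)).1; last by exists J, I; apply/eqP.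
  pose W : 'M[R]_(p, n) := \matrix_(s, a) w s a.
  have Wfree : row_free W.
    apply: inj_row_free => v vW; apply/rowP => s; rewrite mxE.
    apply: (wfree (fun i => v ord0 i)) => a.
    by have /rowP /(_ a) := vW; rewrite !mxE => E; apply: etrans E; apply: eq_bigr => i _; rewrite mxE.
  rewrite -row_leq_rank in Wfree; apply: leq_trans Wfree _.
  pose C : 'M[R]_(p, q) := \matrix_(s, j) c s j.
  (* The independent vectors lie in the span of the fields, so their matrix factors through that of
     the fields and its rank [p] bounds the rank of the latter from below. *)
  have -> : W = mulmx C (trmx (fields_mx g x)).
    apply/matrixP => s a; rewrite !mxE (Hc s a); apply: eq_bigr => j _.
    by rewrite !mxE.
  by rewrite -(mxrank_tr (fields_mx g x)); apply: mxrankM_maxr.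
exists (fun s => g (I s) x); split.
  move=> s; exists (fun j => if j == I s then 1 else 0) => a.
  rewrite /lincomb /sumR (bigD1 (I s)) //= eqxx big1 ?Rplus_0_r ?Rmult_1_l //.
  by move=> j /negbTE ->; rewrite Rmult_0_l.
move=> c Hc s.
have U : mxsub J I (fields_mx g x) \in unitmx by rewrite unitmxE unitfE; apply/eqP.
rewrite -unitmx_tr -row_free_unit in U.
pose cv : 'rV[R]_p := \row_i c i.
have /rowP /(_ s) : cv = 0.
  apply: (row_free_inj U); rewrite mul0mx; apply/rowP => j; rewrite !mxE.
  apply: etrans (Hc (J j)); apply: eq_bigr => i _.
  by rewrite !mxE.
by rewrite !mxE.
Qed.

End HasIndep.

(** * Minors of the fields at points of differentiability *)

Definition real_mx {m k} (f : 'I_m -> 'I_k -> R) : 'M[R]_(m, k) := \matrix_(i, j) f i j.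

Lemma sumR_eq n (f g : 'I_n -> R) : (forall i, f i = g i) -> sumR f = sumR g.
Proof. by move=> H; apply: eq_bigr. Qed.

Lemma sumRD n (f g : 'I_n -> R) : sumR (fun i => f i + g i) = sumR f + sumR g.
Proof. exact: big_split. Qed.

Lemma sumRZ n c (f : 'I_n -> R) : sumR (fun i => c * f i) = c * sumR f.
Proof. by rewrite /sumR big_distrr. Qed.

Lemma sumR_exchange n q (f : 'I_n -> 'I_q -> R) :
  sumR (fun i => sumR (fun j => f i j)) = sumR (fun j => sumR (fun i => f i j)).
Proof. exact: exchange_big. Qed.

Lemma sumR_abs_le n (f : 'I_n -> R) c : (forall i, Rabs (f i) <= c) -> Rabs (sumR f) <= INR n * c.
Proof. by move=> H; have := bigR_abs_le _ f c H; rewrite card_ord. Qed.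

Lemma frechet_line n (f : vec n -> vec n) z A : frechet f z A -> forall (v : vec n) i,
  derivable_pt_lim (fun s => f (fun a => z a + s * v a) i) 0 (sumR (fun b => A i b * v b)).
Proof.
move=> fA v i eta eta0; have v0 := norm1_ge0 _ v.
have e0 : 0 < eta / (2 * (norm1 v + 1)) by apply: Rdiv_lt_0_compat; lra.
have [d [d0 Hd]] := fA _ e0.
have r0 : 0 < d / (norm1 v + 1) by apply: Rdiv_lt_0_compat; lra.
exists (mkposreal _ r0) => h h0 /= hd; rewrite Rplus_0_l.
have -> : (fun a => z a + 0 * v a) = z by apply: funext => a; ring.
have nh : vnorm (fun a => h * v a) <= Rabs h * norm1 v.
  apply: Rle_trans (vnorm_le_norm1 _ _) _; right.
  by rewrite -sumRZ; apply: sumR_eq => a; rewrite Rabs_mult.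
have hp := Rabs_pos_lt h h0.
have lt : vnorm (fun a => h * v a) < d.
  apply: Rle_lt_trans nh _.
  have := Rmult_lt_compat_r (norm1 v + 1) _ _ ltac:(lra) hd.
  have -> : d / (norm1 v + 1) * (norm1 v + 1) = d by field; lra.
  lra.
have := Rle_trans _ _ _ (Rabs_coord_le_vnorm _ _ i) (Hd _ lt).
have -> : sumR (fun b => A i b * (h * v b)) = h * sumR (fun b => A i b * v b).
  by rewrite -sumRZ; apply: sumR_eq => b; ring.
rewrite -/(vec n) /vadd; set a := f _ i; set b := f z i; set s := sumR _ => H.
have -> : (a - b) / h - s = (a - b - h * s) * / h by field.
rewrite Rabs_mult Rabs_inv.
apply: (Rle_lt_trans _ (eta / 2)); last lra.
have -> : eta / 2 = eta / (2 * (norm1 v + 1)) * (Rabs h * (norm1 v + 1)) * / Rabs h by field; lra.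
apply: Rmult_le_compat_r; first by left; apply: Rinv_0_lt_compat.
apply: Rle_trans H _; apply: Rmult_le_compat_l; first lra.
lra.
Qed.

Definition unit_vec {n} (b : 'I_n) : vec n := fun a => if a == b then 1 else 0.

Lemma sumR_unit_vec n (c : 'I_n -> R) b : sumR (fun a => c a * unit_vec b a) = c b.
Proof.
rewrite /sumR (bigD1 b) //= /unit_vec eqxx big1 ?Rplus_0_r ?Rmult_1_r //.
by move=> a /negbTE ->; rewrite Rmult_0_r.
Qed.

Lemma frechet_entry n (f : vec n -> vec n) z A i b : frechet f z A ->
  derivable_pt_lim (fun s => f (fun a => z a + s * unit_vec b a) i) 0 (A i b).
Proof. by move=> fA; have := frechet_line _ _ _ _ fA (unit_vec b) i; rewrite sumR_unit_vec. Qed.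

(** The commutator condition provides derivative matrices for each pair [j], [k] separately;
    uniqueness allows one matrix per field in [good_ptE]. *)
Lemma frechet_unique n (f : vec n -> vec n) z A B : frechet f z A -> frechet f z B -> A = B.
Proof.
move=> fA fB; apply: funext => i; apply: funext => b.
exact: uniqueness_limite (frechet_entry _ _ _ _ i b fA) (frechet_entry _ _ _ _ i b fB).
Qed.

(** An entry of the derivative is a limit of difference quotients along a coordinate axis, each
    bounded by the Lipschitz constant. *)
Lemma frechet_entry_le n (f : vec n -> vec n) c r z A L i b :
  cube c r z -> (forall y y', cube c r y -> cube c r y' -> Rabs (f y i - f y' i) <= L * dist1 y y') ->
  frechet f z A -> Rabs (A i b) <= L.
Proof.
move=> zc lip fA; apply: Rnot_lt_le => lt.
have [mu [mu0 Hmu]] := cube_margin _ _ _ _ zc.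
have [d Hd] := frechet_entry _ _ _ _ i b fA (Rabs (A i b) - L) ltac:(lra).
have dp := cond_pos d.
pose h := Rmin (d / 2) (mu / 2).
have h0 : 0 < h by apply: Rmin_glb_lt; lra.
have hd : h <= d / 2 := Rmin_l _ _; have hm : h <= mu / 2 := Rmin_r _ _.
have := Hd h ltac:(lra) ltac:(rewrite Rabs_pos_eq; lra); rewrite Rplus_0_l.
have -> : (fun a => z a + 0 * unit_vec b a) = z by apply: funext => a; ring.
have ub a : Rabs (unit_vec b a) <= 1 by rewrite /unit_vec; case: eqP => _; rewrite ?Rabs_R1 ?Rabs_R0; lra.
have yc : cube c r (fun a => z a + h * unit_vec b a).
  apply: Hmu => a; rewrite (_ : _ - _ = h * unit_vec b a); last ring.
  by rewrite Rabs_mult (Rabs_pos_eq h); have := ub a; have := Rabs_pos (unit_vec b a); nra.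
have := lip _ _ yc zc.
have -> : dist1 (fun a => z a + h * unit_vec b a) z = h.
  rewrite -[RHS](sumR_unit_vec _ (fun _ => h) b); apply: sumR_eq => a.
  rewrite (_ : _ - _ = h * unit_vec b a); last ring.
  by rewrite /unit_vec; case: eqP => _; rewrite Rabs_pos_eq; lra.
set D := f _ i - f z i => HD.
have Dh : Rabs (D / h) <= L.
  rewrite Rabs_mult Rabs_inv (Rabs_pos_eq h); last lra.
  have -> : L = L * h * / h by field; lra.
  by apply: Rmult_le_compat_r => //; left; apply: Rinv_0_lt_compat.
have := Rabs_triang (D / h) (- (D / h - A i b)).
rewrite Rabs_Ropp (_ : D / h + - (D / h - A i b) = A i b); last ring.
lra.
Qed.

Definition good_pt {q n} (g : 'I_q -> vec n -> vec n) (C : R) (z : vec n) : Prop :=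
  forall j k : 'I_q, exists Aj Ak, frechet (g j) z Aj /\ frechet (g k) z Ak /\
    inPr g C z (fun i => sumR (fun b => Ak i b * g j z b) - sumR (fun b => Aj i b * g k z b)).

(** The commutator bound is restated as an exchange of [j] and [k] in the derivative, up to a
    bounded combination of the fields. *)
Lemma good_ptE q n (g : 'I_q -> vec n -> vec n) C z : good_pt g C z ->
  exists (A : 'I_q -> 'I_n -> 'I_n -> R) (c : 'I_q -> 'I_q -> 'I_q -> R),
    (forall j, frechet (g j) z (A j)) /\
    (forall j k l, Rabs (c j k l) <= C) /\
    forall j k i, sumR (fun b => A k i b * g j z b)
      = sumR (fun b => A j i b * g k z b) + lincomb (c j k) (Yat g z) i.
Proof.
move=> gd.
have /choice [A HA] : forall j, exists A, frechet (g j) z A.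
  by move=> j; have [Aj [_ [H _]]] := gd j j; exists Aj.
have /choice [c Hc] : forall jk : 'I_q * 'I_q, exists c : 'I_q -> R,
    vnorm c <= C /\ forall i, sumR (fun b => A jk.2 i b * g jk.1 z b)
      - sumR (fun b => A jk.1 i b * g jk.2 z b) = lincomb c (Yat g z) i.
  move=> [j k]; have [Aj [Ak [fj [fk [c [cC Hc]]]]]] := gd j k; exists c; split=> // i /=.
  by rewrite (frechet_unique _ _ _ _ _ (HA j) fj) (frechet_unique _ _ _ _ _ (HA k) fk) Hc.
exists A, (fun j k => c (j, k)); split=> //; split.
  by move=> j k l; have [le _] := Hc (j, k); apply: Rle_trans (Rabs_coord_le_vnorm _ _ l) le.
by move=> j k i; have [_ /(_ i) /=] := Hc (j, k); lra.
Qed.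

Section LocalMinors.
Variables (q n p : nat) (g : 'I_q -> vec n -> vec n).

Definition minor_index : finType := ({ffun 'I_p -> 'I_n} * {ffun 'I_p -> 'I_q})%type.

Definition minor_at (al : minor_index) (z : vec n) : R :=
  minor R n q p (fields_mx g z) al.1 al.2.

Definition minor_sum (z : vec n) : R := \big[Rplus/R0]_(al : minor_index) Rabs (minor_at al z).

Lemma minor_sum_ge0 z : 0 <= minor_sum z.
Proof. by apply: bigR_ge0 => al _; apply: Rabs_pos. Qed.

Lemma minor_at_le z J I : Rabs (minor R n q p (fields_mx g z) J I) <= minor_sum z.
Proof. by apply: (bigR_term_le _ (fun al => Rabs (minor_at al z)) (J, I)) => al; apply: Rabs_pos. Qed.

Lemma minor_sum_eq0 z : minor_sum z = 0 <-> ~ has_indep g z p.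
Proof.
rewrite has_indepP; split=> [z0 [J [I]]|no].
  by move=> /Rabs_pos_lt; have := minor_at_le z J I; lra.
apply: big1 => -[J I] _; rewrite /minor_at /=.
have [->|nz] := Req_dec (minor R n q p (fields_mx g z) J I) 0; first exact: Rabs_R0.
by case: no; exists J, I.
Qed.

Variables (c : vec n) (r : R).
Hypothesis g_bdd_lip : forall j i, bdd_lip (cube c r) dist1 (fun z => g j z i).

Lemma minor_bdd_lip : exists K, 0 <= K /\ forall al y z, cube c r y -> cube c r z ->
  Rabs (minor_at al y - minor_at al z) <= K * dist1 y z.
Proof.
have [||K [K0 HK]] := finite_upper_bound minor_index (fun al K => forall y z, cube c r y -> cube c r z ->
  Rabs (minor_at al y - minor_at al z) <= K * dist1 y z).
- move=> al K K' KK' H y z yc zc; apply: Rle_trans (H y z yc zc) _.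
  by apply: Rmult_le_compat_r => //; apply: dist1_ge0.
- move=> al; have [|K [_ [_ H]]] := bdd_lip_det _ (cube c r) dist1 (@dist1_ge0 n) p (fun z => mxsub al.1 al.2 (fields_mx g z)).
    move=> i j; rewrite (_ : (fun x => _) = (fun z => g (al.2 j) z (al.1 i))) //.
    by apply: funext => z; rewrite !mxE.
  by exists K.
by exists K.
Qed.

Lemma cofactor_bound : exists K, 0 <= K /\ forall (al : minor_index) (s t : 'I_p) z, cube c r z ->
  Rabs (cofactor (mxsub al.1 al.2 (fields_mx g z)) s t) <= K.
Proof.
have [||K [K0 HK]] := finite_upper_bound (minor_index * ('I_p * 'I_p))%type
  (fun w K => forall z, cube c r z ->
     Rabs (cofactor (mxsub w.1.1 w.1.2 (fields_mx g z)) w.2.1 w.2.2) <= K).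
- by move=> w K K' KK' H z zc; apply: Rle_trans (H z zc) KK'.
- move=> [al [s t]] /=; have [|K [_ [H _]]] := bdd_lip_cofactor _ (cube c r) dist1 (@dist1_ge0 n) p (fun z => mxsub al.1 al.2 (fields_mx g z)) s t.
    move=> i j; rewrite (_ : (fun x => _) = (fun z => g (al.2 j) z (al.1 i))) //.
    by apply: funext => z; rewrite !mxE.
  by exists K.
by exists K; split=> // al s t z zc; apply: (HK (al, (s, t))).
Qed.

Lemma fields_lip : exists L, 0 <= L /\ forall j i y z, cube c r y -> cube c r z ->
  Rabs (g j y i - g j z i) <= L * dist1 y z.
Proof.
have [||L [L0 HL]] := finite_upper_bound ('I_q * 'I_n)%type (fun w L => forall y z, cube c r y -> cube c r z ->
  Rabs (g w.1 y w.2 - g w.1 z w.2) <= L * dist1 y z).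
- move=> w K K' KK' H y z yc zc; apply: Rle_trans (H y z yc zc) _.
  by apply: Rmult_le_compat_r => //; apply: dist1_ge0.
- by move=> [j i]; have [K [_ [_ H]]] := g_bdd_lip j i; exists K.
by exists L; split=> // j i; apply: (HL (j, i)).
Qed.

(* At a good point the matrix [G] of the fields satisfies [D_v G = B G + G E + Err] with
   [B], [E] bounded, where [Err] vanishes when [v] is the combination of the fields with
   coefficients [u]; by multilinearity the minors satisfy a homogeneous linear estimate. *)
Lemma good_pt_minor C : 0 <= C -> exists C1 C2, 0 <= C1 /\ 0 <= C2 /\
  forall z, cube c r z -> good_pt g C z -> forall al (v : vec n),
  exists d, derivable_pt_lim (fun s => minor_at al (fun a => z a + s * v a)) 0 d /\
    forall u : 'I_q -> R, (forall j, Rabs (u j) <= 1) ->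
      Rabs d <= C1 * minor_sum z + C2 * dist1 v (lincomb u (Yat g z)).
Proof.
move=> C0; have [L [L0 HL]] := fields_lip; have [K [K0 HK]] := cofactor_bound.
have [n0 [q0 p0]] := (pos_INR n, (pos_INR q, pos_INR p)).
(* The first summand counts row replacements, with entries of [B] at most [q L]; the second counts
   column replacements, with entries of [E] at most [q C]. In the last constant [p * p] entries of
   [Err] are multiplied by cofactors bounded by [K]. *)
exists (INR p * (INR n * (INR q * L)) + INR p * (INR q * (INR q * C))), (INR p * (INR p * (L * K))).
split; first by apply: Rplus_le_le_0_compat; repeat apply: Rmult_le_pos => //.
split; first by repeat apply: Rmult_le_pos => //.
move=> z zc /good_ptE [A [e [fA [eC He]]]] [J I] v.
have AL j i b : Rabs (A j i b) <= L.
  apply: (frechet_entry_le n (g j) c r z (A j) L i b zc) => // y y' yc yc'; exact: HL.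
pose X : 'M[R]_(n, q) := real_mx (fun i k => sumR (fun b => A k i b * v b)).
exists (ddet R p (mxsub J I (fields_mx g z)) (mxsub J I X)); split.
  have -> : mxsub J I (fields_mx g z) = mxsub J I (fields_mx g (fun a => z a + 0 * v a)).
    by congr (mxsub J I (fields_mx g _)); apply: funext => a; ring.
  apply: (derivable_pt_lim_det p (fun s => mxsub J I (fields_mx g (fun a => z a + s * v a)))) => s t.
  rewrite !mxE; under eq_fun do rewrite !mxE.
  exact: frechet_line.
move=> u u1; set w := lincomb u (Yat g z).
pose B : 'M[R]_n := real_mx (fun i b => sumR (fun j => u j * A j i b)).
pose E : 'M[R]_q := real_mx (fun l k => sumR (fun j => u j * e j k l)).
pose Err : 'M[R]_(n, q) := real_mx (fun i k => sumR (fun b => A k i b * (v b - w b))).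
have XE : X = ((mulmx B (fields_mx g z) + mulmx (fields_mx g z) E)%R + Err)%R.
  apply/matrixP => i k; rewrite !mxE.
  have -> : (\sum_j B i j * fields_mx g z j k)%R = sumR (fun j => u j * sumR (fun b => A j i b * g k z b)).
    transitivity (sumR (fun b => sumR (fun j => u j * (A j i b * g k z b)))).
      apply: eq_bigr => b _; rewrite !mxE /sumR big_distrl /=; apply: eq_bigr => j _.
      by rewrite /GRing.mul /= Rmult_assoc.
    by rewrite sumR_exchange; apply: sumR_eq => j; rewrite sumRZ.
  have -> : (\sum_j fields_mx g z i j * E j k)%R = sumR (fun j => u j * lincomb (e j k) (Yat g z) i).
    transitivity (sumR (fun l => sumR (fun j => u j * (e j k l * g l z i)))).
      apply: eq_bigr => l _.
      transitivity (g l z i * sumR (fun j => u j * e j k l)); first by rewrite !mxE.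
      rewrite -sumRZ; apply: sumR_eq => j; ring.
    by rewrite sumR_exchange; apply: sumR_eq => j; rewrite sumRZ.
  change (sumR (fun b => A k i b * v b) =
    sumR (fun j => u j * sumR (fun b => A j i b * g k z b)) + sumR (fun j => u j * lincomb (e j k) (Yat g z) i)
    + sumR (fun b => A k i b * (v b - w b))).
  rewrite -sumRD.
  (* The exchange [He], summed against [u], identifies the entries of [B G + G E] with the
     derivative of [g k] along [w]. *)
  have -> : sumR (fun j => u j * sumR (fun b => A j i b * g k z b) + u j * lincomb (e j k) (Yat g z) i)
      = sumR (fun b => A k i b * w b).
    transitivity (sumR (fun j => sumR (fun b => A k i b * (u j * g j z b)))).
      apply: sumR_eq => j; rewrite -Rmult_plus_distr_l -He -sumRZ; apply: sumR_eq => b; ring.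
    by rewrite sumR_exchange; apply: sumR_eq => b; rewrite sumRZ.
  by rewrite -sumRD; apply: sumR_eq => b; ring.
have -> : mxsub J I X = ((mxsub J I (mulmx B (fields_mx g z)) + mxsub J I (mulmx (fields_mx g z) E))%R + mxsub J I Err)%R.
  by rewrite XE; apply/matrixP => s t; rewrite !mxE.
rewrite !ddetD ddet_mull ddet_mulr.
have Mz := minor_sum_ge0 z.
have b1 : Rabs (\sum_s \sum_b B (J s) b * minor R n q p (fields_mx g z) (ffun_upd p n J s b) I)%R
    <= INR p * (INR n * (INR q * L * minor_sum z)).
  apply: sumR_abs_le => s; apply: sumR_abs_le => b; rewrite Rabs_mult.
  apply: Rmult_le_compat; [exact: Rabs_pos | exact: Rabs_pos | | exact: minor_at_le].
  rewrite mxE; apply: sumR_abs_le => j; rewrite Rabs_mult.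
  by have := Rmult_le_compat _ _ _ _ (Rabs_pos _) (Rabs_pos _) (u1 j) (AL j (J s) b); lra.
have b2 : Rabs (\sum_t \sum_l E l (I t) * minor R n q p (fields_mx g z) J (ffun_upd p q I t l))%R
    <= INR p * (INR q * (INR q * C * minor_sum z)).
  apply: sumR_abs_le => s; apply: sumR_abs_le => l; rewrite Rabs_mult.
  apply: Rmult_le_compat; [exact: Rabs_pos | exact: Rabs_pos | | exact: minor_at_le].
  rewrite mxE; apply: sumR_abs_le => j; rewrite Rabs_mult.
  by have := Rmult_le_compat _ _ _ _ (Rabs_pos _) (Rabs_pos _) (u1 j) (eC j (I s) l); lra.
have b3 : Rabs (ddet R p (mxsub J I (fields_mx g z)) (mxsub J I Err)) <= INR p * (INR p * (L * dist1 v w * K)).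
  apply: sumR_abs_le => s; apply: sumR_abs_le => t; rewrite Rabs_mult.
  apply: Rmult_le_compat; [exact: Rabs_pos | exact: Rabs_pos | | exact: (HK (J, I))].
  rewrite !mxE; apply: Rle_trans (bigR_abs _ _ _) _; rewrite -sumRZ; apply: bigR_le => b _.
  by rewrite Rabs_mult; apply: Rmult_le_compat_r; [apply: Rabs_pos | apply: AL].
apply: Rle_trans (Rabs_triang _ _) _.
apply: Rle_trans (Rplus_le_compat_r _ _ _ (Rabs_triang _ _)) _.
apply: Rle_trans (Rplus_le_compat _ _ _ _ (Rplus_le_compat _ _ _ _ b1 b2) b3) _.
by right; ring.
Qed.

End LocalMinors.

(** * Propagation along subunit curves *)

Section Propagation.
Variables (q n p : nat) (g : 'I_q -> vec n -> vec n).

Local Notation F := (minor_at q n p g).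
Local Notation M := (minor_sum q n p g).
Local Notation card_minors := (INR #|minor_index q n p|).

Lemma minor_sum_diff y z c : (forall al, Rabs (F al y - F al z) <= c) ->
  Rabs (M y - M z) <= card_minors * c.
Proof.
move=> H; rewrite -bigR_const; apply: Rle_trans (bigR_le _ _ predT _ _ (fun al _ => H al)).
apply: (big_ind3 (fun a b c => Rabs (a - b) <= c)).
- by rewrite Rminus_diag Rabs_R0; lra.
- move=> a1 b1 c1 a2 b2 c2 H1 H2; rewrite (_ : a1 + a2 - (b1 + b2) = (a1 - b1) + (a2 - b2)); last ring.
  by have := Rabs_triang (a1 - b1) (a2 - b2); lra.
- by move=> al _; apply: Rabs_triang_inv2.
Qed.

Section Local.
Variables (c : vec n) (r : R).
Hypothesis g_bdd_lip : forall j i, bdd_lip (cube c r) dist1 (fun z => g j z i).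

(** The almost everywhere bound of [good_pt_minor] is integrated along segments parallel to the
    direction frozen at [x]. [C1] depends on the cube but not on [x], [u] or [eta], as Gronwall
    requires. *)
Lemma minor_pointwise_pos : condH g -> exists C1, 0 <= C1 /\ forall x, cube c r x ->
  forall u : 'I_q -> R, (forall j, Rabs (u j) <= 1) -> forall eta, 0 < eta ->
  exists H, 0 < H /\ forall h, 0 < h < H -> forall al,
    Rabs (F al (fun a => x a + h * lincomb u (Yat g x) a) - F al x) <= h * (C1 * M x + eta).
Proof.
move=> /(_ _ (cube_open n c r) (cube_bounded n c r)) [C [C0 nullN]].
have [C1 [C2 [C10 [C20 Hgood]]]] := good_pt_minor q n p g c r g_bdd_lip C ltac:(lra).
have [K [K0 HK]] := minor_bdd_lip q n p g c r g_bdd_lip.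
have [L [L0 HL]] := fields_lip q n g c r g_bdd_lip.
exists C1; split=> // x xc u u1 eta eta0; set v := lincomb u (Yat g x).
have [n0 [q0 N0]] := (pos_INR n, (pos_INR q, pos_INR #|minor_index q n p|)).
have v0 := norm1_ge0 _ v.
(* Error per unit of [dist1] between [z] and [x]: the variation of the sum of minors, and that of
   the combination of the fields with coefficients [u]. *)
pose C4 := C1 * (card_minors * K) + C2 * (INR n * (INR q * L)).
have C40 : 0 <= C4 by apply: Rplus_le_le_0_compat; repeat apply: Rmult_le_pos => //.
have C4n : 0 <= C4 * INR n by apply: Rmult_le_pos.
have [mu [mu0 Hmu]] := cube_margin _ _ _ _ xc.
pose th := Rmin (mu / 2) (eta / (C4 * INR n + 1)).
have th0 : 0 < th by apply: Rmin_glb_lt; [lra | apply: Rdiv_lt_0_compat; lra].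
have th_mu : th <= mu / 2 := Rmin_l _ _.
have th_eta : C4 * (INR n * th) <= eta.
  have : (C4 * INR n + 1) * th <= (C4 * INR n + 1) * (eta / (C4 * INR n + 1)).
    by apply: Rmult_le_compat_l; [lra | apply: Rmin_r].
  have -> : (C4 * INR n + 1) * (eta / (C4 * INR n + 1)) = eta by field; lra.
  lra.
(* Half of the radius [th] is spent on moving along [v], the other half on the translations. *)
exists (th / (2 * (norm1 v + 1))); split; first by apply: Rdiv_lt_0_compat; lra.
move=> h hH al.
have hv : h * norm1 v <= th / 2.
  have : h * (norm1 v + 1) <= th / (2 * (norm1 v + 1)) * (norm1 v + 1) by apply: Rmult_le_compat_r; lra.
  have -> : th / (2 * (norm1 v + 1)) * (norm1 v + 1) = th / 2 by field; lra.
  lra.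
have near (y : vec n) s : (forall i, 0 <= y i <= th / 2) -> 0 <= s <= h ->
    forall i, Rabs (x i + y i + s * v i - x i) <= th.
  move=> yth sh i; rewrite (_ : _ - _ = y i + s * v i); last ring.
  apply: Rle_trans (Rabs_triang _ _) _; rewrite Rabs_mult (Rabs_pos_eq s); last lra.
  have vi : Rabs (v i) <= norm1 v := bigR_term_le _ (fun i => Rabs (v i)) i (fun j => Rabs_pos _).
  have := Rmult_le_compat _ _ _ _ (proj1 sh) (Rabs_pos (v i)) (proj2 sh) vi.
  by rewrite (Rabs_pos_eq (y i)); have := yth i; lra.
(* The one-sided bound is applied to the minor and to its negative, which gives the absolute
   value. *)
have main sg : (sg = 1 \/ sg = -1) ->
    sg * F al (fun a => x a + h * v a) - sg * F al x <= (C1 * M x + eta) * h.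
  move=> sg1; have sgA : Rabs sg = 1 by case: sg1 => ->; rewrite ?Rabs_Ropp Rabs_R1.
  apply: (lipschitz_ae_direction n (cube c r) _ (fun z => sg * F al z) K _ h (th / 2) x v K0 _ nullN);
    [|lra|lra|].
    by move=> y z yc zc; rewrite -Rmult_minus_distr_l Rabs_mult sgA Rmult_1_l; apply: HK.
  move=> y s yth sh z; have zx := near y s yth sh.
  have zc : cube c r z by apply: Hmu => i; have := zx i; rewrite -/(z i); lra.
  split=> // Nz; have gz : good_pt g C z by apply: NNPP => ng; apply: Nz.
  have [d [Fd dle]] := Hgood z zc gz al v; exists (sg * d); split.
    exact: (derivable_pt_lim_scal (fun s => F al (fun a => z a + s * v a)) sg).
  apply: Rle_trans (Rle_abs _) _; rewrite Rabs_mult sgA Rmult_1_l.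
  apply: Rle_trans (dle u u1) _.
  have zx1 : dist1 z x <= INR n * th by apply: dist1_le.
  have xz1 : dist1 x z <= INR n * th by apply: dist1_le => i; rewrite Rabs_minus_sym; apply: zx.
  have Mz : M z <= M x + card_minors * (K * (INR n * th)).
    have : Rabs (M z - M x) <= card_minors * (K * (INR n * th)).
      apply: minor_sum_diff => be; apply: Rle_trans (HK be z x zc xc) _.
      by apply: Rmult_le_compat_l.
    by move=> /Rabs_le_between; lra.
  have w : dist1 v (lincomb u (Yat g z)) <= INR n * (INR q * (L * (INR n * th))).
    apply: dist1_le => i; rewrite /v /lincomb.
    have -> : sumR (fun j => u j * Yat g x j i) - sumR (fun j => u j * Yat g z j i)
        = sumR (fun j => u j * (g j x i - g j z i)).
      have : sumR (fun j => u j * Yat g x j i) = sumR (fun j => u j * (g j x i - g j z i)) + sumR (fun j => u j * Yat g z j i).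
        by rewrite -sumRD; apply: sumR_eq => j; rewrite /Yat; ring.
      by move=> ->; ring.
    apply: sumR_abs_le => j; rewrite Rabs_mult.
    have H1 := HL j i x z xc zc.
    have H2 : L * dist1 x z <= L * (INR n * th) by apply: Rmult_le_compat_l.
    by have := Rmult_le_compat _ _ _ _ (Rabs_pos _) (Rabs_pos _) (u1 j) (Rle_trans _ _ _ H1 H2); lra.
  have := Rmult_le_compat_l C1 _ _ C10 Mz; have := Rmult_le_compat_l C2 _ _ C20 w.
  by move: th_eta; rewrite /C4; lra.
have := main 1 ltac:(by left); have := main (-1) ltac:(by right) => m1 m2.
by apply: Rabs_le; lra.
Qed.

Lemma minor_pointwise : condH g -> exists C1, 0 <= C1 /\ forall x, cube c r x ->
  forall u : 'I_q -> R, (forall j, Rabs (u j) <= 1) -> forall eta, 0 < eta ->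
  exists H, 0 < H /\ forall h, Rabs h < H -> forall al,
    Rabs (F al (fun a => x a + h * lincomb u (Yat g x) a) - F al x) <= Rabs h * (C1 * M x + eta).
Proof.
move=> /minor_pointwise_pos [C1 [C10 Hpos]]; exists C1; split=> // x xc u u1 eta eta0.
have [H1 [H10 HH1]] := Hpos x xc u u1 eta eta0.
(* The coefficient set is symmetric, so a negative [h] is a positive step in the direction with
   coefficients [- u]. *)
have [|H2 [H20 HH2]] := Hpos x xc (fun j => - u j) _ eta eta0; first by move=> j; rewrite Rabs_Ropp.
exists (Rmin H1 H2); split; first exact: Rmin_glb_lt.
have l1 := Rmin_l H1 H2; have l2 := Rmin_r H1 H2.
move=> h hH al; have [hp|[<-|hn]] := Rtotal_order 0 h.
- have E := Rabs_pos_eq h ltac:(lra); rewrite E in hH; rewrite E.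
  by apply: HH1; lra.
- rewrite (_ : (fun a => x a + 0 * _) = x); last by apply: funext => a; ring.
  by rewrite Rminus_diag Rabs_R0; lra.
- have E := Rabs_left h ltac:(lra); rewrite E in hH; rewrite E.
  have := HH2 (- h) ltac:(lra) al.
  have -> // : (fun a => x a + - h * lincomb (fun j => - u j) (Yat g x) a)
      = (fun a => x a + h * lincomb u (Yat g x) a).
  apply: funext => a; congr (_ + _); rewrite /lincomb.
  have -> : sumR (fun j => - u j * Yat g x j a) = - 1 * sumR (fun j => u j * Yat g x j a).
    by rewrite -sumRZ; apply: sumR_eq => j; ring.
  ring.
Qed.

(** The point [gam (t + h)] is compared with the tangent point [gam t + h * v]: they differ by
    [o(h)], which the Lipschitz minors preserve, and the tangent point is covered by
    [minor_pointwise]. *)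
Lemma minor_sum_log_dini : condH g -> exists C, 0 <= C /\
  forall (gam : R -> vec n) (u : 'I_q -> R) a b t, a <= t <= b ->
    (forall s, a <= s <= b -> cube c r (gam s)) -> (forall j, Rabs (u j) <= 1) ->
    (forall i, derivable_pt_lim (fun s => gam s i) t (lincomb u (Yat g (gam t)) i)) ->
    log_dini_le C (fun s => M (gam s)) a b t.
Proof.
move=> /minor_pointwise [C1 [C10 Hpt]].
have [K [K0 HK]] := minor_bdd_lip q n p g c r g_bdd_lip.
have [n0 N0] := (pos_INR n, pos_INR #|minor_index q n p|).
exists (card_minors * C1); split; first exact: Rmult_le_pos.
move=> gam u a b t tab gc u1 gd eta eta0; set v := lincomb u (Yat g (gam t)).
have xc := gc t tab; have v0 := norm1_ge0 _ v.
have NKn : 0 <= card_minors * (K * INR n) by repeat apply: Rmult_le_pos => //.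
(* Half of [eta] goes to the pointwise estimate, summed over all minors, and half, through [e2], to
   the deviation of the curve from its tangent. *)
pose e1 := eta / (2 * (card_minors + 1)).
have e10 : 0 < e1 by apply: Rdiv_lt_0_compat; lra.
have Ne1 : card_minors * e1 <= eta / 2.
  have -> : eta / 2 = (card_minors + 1) * e1 by rewrite /e1; field; lra.
  lra.
pose e2 := eta / (2 * (card_minors * (K * INR n) + 1)).
have e20 : 0 < e2 by apply: Rdiv_lt_0_compat; lra.
have Ne2 : card_minors * (K * INR n) * e2 <= eta / 2.
  have -> : eta / 2 = (card_minors * (K * INR n) + 1) * e2 by rewrite /e2; field; lra.
  lra.
have [H [H0 HH]] := Hpt _ xc u u1 e1 e10.
have [mu [mu0 Hmu]] := cube_margin _ _ _ _ xc.
have [||d [d0 Hd]] := finite_pos_lower_bound _ (fun (i : 'I_n) d => forall h, Rabs h < d ->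
    Rabs (gam (t + h) i - (gam t i + h * v i)) <= Rabs h * e2).
- by move=> i d d' dd' Hi h hd'; apply: Hi; lra.
- move=> i; have [d Hi] := gd i e2 e20; exists d; split; first exact: cond_pos.
  move=> h hd; have [->|hn0] := Req_dec h 0.
    by rewrite Rplus_0_r Rmult_0_l Rplus_0_r Rminus_diag Rabs_R0; lra.
  have := Hi h hn0 hd; rewrite -/v => lt.
  have -> : gam (t + h) i - (gam t i + h * v i) = h * ((gam (t + h) i - gam t i) / h - v i) by field.
  by rewrite Rabs_mult; apply: Rmult_le_compat_l; [apply: Rabs_pos | lra].
exists (Rmin H (Rmin d (mu / (norm1 v + 1)))); split.
  by do 2!apply: Rmin_glb_lt => //; apply: Rdiv_lt_0_compat; lra.
move=> h hlt thab.
have hH : Rabs h < H := Rlt_le_trans _ _ _ hlt (Rmin_l _ _).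
have hlt' := Rlt_le_trans _ _ _ hlt (Rmin_r _ _).
have hd : Rabs h < d := Rlt_le_trans _ _ _ hlt' (Rmin_l _ _).
have hm : Rabs h < mu / (norm1 v + 1) := Rlt_le_trans _ _ _ hlt' (Rmin_r _ _).
have hp := Rabs_pos h.
have yc : cube c r (fun i => gam t i + h * v i).
  apply: Hmu => i; rewrite (_ : _ - _ = h * v i); last ring.
  have vi : Rabs (v i) <= norm1 v := bigR_term_le _ (fun i => Rabs (v i)) i (fun j => Rabs_pos _).
  rewrite Rabs_mult.
  have := Rmult_le_compat_l _ _ _ hp vi.
  have := Rmult_lt_compat_r (norm1 v + 1) _ _ ltac:(lra) hm.
  have -> : mu / (norm1 v + 1) * (norm1 v + 1) = mu by field; lra.
  lra.
apply: Rle_trans (minor_sum_diff _ _ (Rabs h * (C1 * M (gam t) + e1) + K * (INR n * (Rabs h * e2))) _) _.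
  move=> al; have := HH h hH al; rewrite -/v.
  have := HK al _ _ (gc _ thab) yc.
  have := Rmult_le_compat_l K _ _ K0 (dist1_le n (gam (t + h)) (fun i => gam t i + h * v i) _ (fun i => Hd i h hd)).
  set A := F al _; set B := F al _; set D := F al _ => ? ? ?.
  have := Rabs_triang (A - B) (B - D); rewrite (_ : A - B + (B - D) = A - D); last ring.
  lra.
have := Rmult_le_compat_l _ _ _ hp Ne1; have := Rmult_le_compat_l _ _ _ hp Ne2; lra.
Qed.

End Local.

(** The Lipschitz and Gronwall constants belong to a cube around [gam t0], so the conclusion is
    restricted to times at which the curve stays in that cube. *)
Lemma minor_sum_locally_constant T gam : (forall j, locally_lipschitz (g j)) -> condH g ->
  subunit g T gam -> forall t0, 0 <= t0 <= T -> exists rho, 0 < rho /\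
  forall s, 0 <= s <= T -> Rabs (s - t0) < rho -> (M (gam t0) = 0 <-> M (gam s) = 0).
Proof.
move=> gl gH [T0 [[Lg gamL] [u [_ nE]]]] t0 t0T.
have [||r [r0 g_bdd_lip]] := finite_pos_lower_bound _
    (fun (j : 'I_q) r => forall i, bdd_lip (cube (gam t0) r) dist1 (fun z => g j z i)).
- move=> j r r' rr' H i; apply: bdd_lip_subset (H i) => z zc k.
  by have := zc k; lra.
- by move=> j; apply: locally_lipschitz_bdd_lip.
have [K [K0 HK]] := minor_bdd_lip q n p g _ r g_bdd_lip.
have [C [C0 HC]] := minor_sum_log_dini _ r g_bdd_lip gH.
have [n0 N0] := (pos_INR n, pos_INR #|minor_index q n p|).
have Lg0 := Rabs_pos Lg.
have gamL1 s t i : 0 <= s <= T -> 0 <= t <= T -> Rabs (gam s i - gam t i) <= Rabs Lg * Rabs (s - t).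
  move=> sT tT; apply: Rle_trans (Rabs_coord_le_vnorm _ (vsub (gam s) (gam t)) i) _.
  apply: Rle_trans (gamL s t sT tT) _.
  by apply: Rmult_le_compat_r; [apply: Rabs_pos | apply: Rle_abs].
pose rho := r / (Rabs Lg + 1); have rho0 : 0 < rho by apply: Rdiv_lt_0_compat; lra.
exists rho; split=> //.
have inc s : 0 <= s <= T -> Rabs (s - t0) < rho -> cube (gam t0) r (gam s).
  move=> sT st i; apply: Rle_lt_trans (gamL1 s t0 i sT t0T) _.
  have -> : r = (Rabs Lg + 1) * rho by rewrite /rho; field; lra.
  have := Rabs_pos (s - t0); nra.
have main a b : 0 <= a -> a <= b -> b <= T -> (forall s, a <= s <= b -> Rabs (s - t0) < rho) ->
    (M (gam a) = 0 <-> M (gam b) = 0).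
  move=> a0 ab bT close.
  have ins s : a <= s <= b -> cube (gam t0) r (gam s) by move=> sab; apply: inc; [lra | apply: close].
  apply: (gronwall_zero (fun s => M (gam s)) a b (card_minors * (K * (INR n * Rabs Lg))) C _ ab _ C0 _ nE).
  - by repeat apply: Rmult_le_pos => //.
  - move=> s t sab tab; rewrite !Rmult_assoc; apply: minor_sum_diff => al.
    apply: Rle_trans (HK al _ _ (ins s sab) (ins t tab)) _; apply: Rmult_le_compat_l => //.
    by apply: dist1_le => i; apply: gamL1; lra.
  - by move=> t _; apply: minor_sum_ge0.
  - move=> t tab nEt.
    have [u1 ud] : vnorm (u t) <= 1 /\ forall i, derivable_pt_lim (fun s => gam s i) t (lincomb (u t) (Yat g (gam t)) i).
      by apply: NNPP => no; apply: nEt; split=> //; lra.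
    apply: (HC gam (u t)) => // j.
    exact: Rle_trans (Rabs_coord_le_vnorm _ _ j) u1.
move=> s sT /Rabs_def2 st; have [le|lt] := Rle_lt_dec t0 s.
  by apply: main; try lra; move=> s' ?; apply: Rabs_def1; lra.
by apply: iff_sym; apply: main; try lra; move=> s' ?; apply: Rabs_def1; lra.
Qed.

(** The local statement makes both the step and the limit case of [real_induction] immediate;
    carrying an equivalence propagates vanishing and nonvanishing together. *)
Lemma orbit_minor_sum x0 x : (forall j, locally_lipschitz (g j)) -> condH g ->
  orbit g x0 x -> (M x0 = 0 <-> M x = 0).
Proof.
move=> gl gH [T [gam [sub [/funext <- /funext <-]]]].
have loc := minor_sum_locally_constant T gam gl gH sub.
have T0 : 0 <= T by case: sub.
apply: (real_induction 0 T (fun t => M (gam 0) = 0 <-> M (gam t) = 0)) => //.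
- move=> t tT Pt; have [rho [rho0 H]] := loc t ltac:(lra).
  exists (Rmin (T - t) (rho / 2)).
  have h0 : 0 < Rmin (T - t) (rho / 2) by apply: Rmin_glb_lt; lra.
  have h1 := Rmin_l (T - t) (rho / 2); have h2 := Rmin_r (T - t) (rho / 2).
  split=> //; split; first lra.
  by rewrite Pt; apply: H; [lra | apply: Rabs_def1; lra].
- move=> t tT Hs; have [rho [rho0 H]] := loc t ltac:(lra).
  have [s [st [s0 Ps]]] := Hs rho rho0.
  by rewrite Ps; apply: iff_sym; apply: H; [lra | apply: Rabs_def1; lra].
Qed.

End Propagation.

Theorem theorem2p1 (n q : nat) (g : 'I_q -> vec n -> vec n) :
  (forall j, locally_lipschitz (g j)) ->
  condH g ->
  forall x0 x : vec n, orbit g x0 x ->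
  forall m : nat, dimP g x m <-> dimP g x0 m.
Proof.
move=> gl gH x0 x orb m.
(* [dimP] at [m] combines [has_indep] for [m] with its negation for [m + 1], so agreement for every
   [p] settles the dimension. *)
have indepE p : has_indep g x p <-> has_indep g x0 p.
  have := orbit_minor_sum q n p g x0 x gl gH orb; rewrite !minor_sum_eq0.
  by move=> H; split=> indic; apply: NNPP => no; apply: (H.1 _ indic) || apply: (H.2 _ indic).
by rewrite /dimP -!/(has_indep _ _ _) !indepE.
Qed.
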